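(* Let $G$ be a complex reductive group and let $V, W$ be (rational, finite-dimensional) representations of $G$. Suppose $v \in V$ is such that its orbit $G\cdot v$ is closed in $V$, and let $H = \mathrm{Stab}_G(v) = \{g \in G \mid g\cdot v = v\}$ be a closed reductive subgroup of $G$. Then there is a degree non-increasing surjective homomorphism $$\phi : \mathbb{C}[V\oplus W]^G \twoheadrightarrow \mathbb{C}[W]^H.$$ In particular, $$\beta_G(V\oplus W) \ge \beta_H(W) \quad\text{and}\quad \sigma_G(V\oplus W) \ge \sigma_H(W).$$
   Context: The ground field is $\mathbb{C}$. For a rational representation $U$ of a reductive group $G$, $\mathbb{C}[U]$ is the ring of polynomial functions on $U$ with its standard grading by degree, $\mathbb{C}[U]^G=\bigoplus_{d\ge 0}\mathbb{C}[U]^G_d$ is the graded ring of invariants, and $\beta_G(U)$ is the smallest integer $D\ge 0$ such that the homogeneous invariants of degree $\le D$ generate $\mathbb{C}[U]^G$ as a $\mathbb{C}$-algebra. The null cone $\mathcal{N}\subseteq U$ is the common zero set of all homogeneous invariants of positive degree; $\sigma_G(U)$ is the smallest integer $D\ge 0$ such that $\mathcal{N}$ equals the common zero set of the homogeneous invariants of degrees $1,\dots,D$. The group $H$ acts on $W$ by restriction of the $G$-action. A homomorphism $\phi$ of such $\mathbb{C}$-algebras is degree non-increasing if $\phi(f)$ has degree at most $\deg f$ for every $f$. *)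

(* Defs.v *)
From HB Require Import structures.
From mathcomp Require Import all_boot all_order all_algebra.
From mathcomp Require Import boolp classical_sets reals.
From mathcomp Require Import complex mpoly.

Set Implicit Arguments.
Unset Strict Implicit.
Unset Printing Implicit Defensive.

Import GRing.Theory.
Local Open Scope classical_set_scope.
Local Open Scope ring_scope.

(* The field of complex numbers is R[i] for R : realType.  Since it is
   infinite, polynomial functions on C^m are identified with {mpoly R[i][m]}. *)

Definition peval (R : realType) (m : nat) (f : {mpoly R[i][m]})
  (x : 'cV[R[i]]_m) : R[i] := f.@[fun i => x i 0].

Definition zero_locus (R : realType) (m : nat) (S : set {mpoly R[i][m]}) :
  set 'cV[R[i]]_m := [set x | forall f, S f -> peval f x = 0].

Definition zariski_closed (R : realType) (m : nat) (Z : set 'cV[R[i]]_m) : Prop :=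
  exists S : set {mpoly R[i][m]}, Z = zero_locus S.

Definition mxcoord (R : realType) (n : nat) (g : 'M[R[i]]_n) :
  'cV[R[i]]_(n * n) := (mxvec g)^T.

(* A linear algebraic group: a subgroup of GL_n that is Zariski closed in GL_n. *)
Record algebraic_group (R : realType) (n : nat) (G : set 'M[R[i]]_n) : Prop := {
  algebraic_group1 : G 1%:M;
  algebraic_groupM : forall g h, G g -> G h -> G (g *m h);
  algebraic_groupV : forall g, G g -> G (invmx g);
  algebraic_group_closed : exists S : set {mpoly R[i][n * n]},
    G = [set g | g \in unitmx /\ zero_locus S (mxcoord g)] }.

(* Regular functions on G are the restrictions of elements of
   C[x_ij, 1/det]. *)
Definition regular_fun (R : realType) (n : nat) (G : set 'M[R[i]]_n)
  (a : 'M[R[i]]_n -> R[i]) : Prop :=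
  exists (p : {mpoly R[i][n * n]}) (k : nat),
    forall g, G g -> a g = peval p (mxcoord g) / (\det g) ^+ k.

(* A representation of G on C^m (acting on column vectors on the left) is given
   by a function on all matrices of which only the values on G are relevant;
   restricting it to a subgroup therefore leaves the function unchanged. *)
Record rational_rep (R : realType) (n : nat) (G : set 'M[R[i]]_n) (m : nat)
    (rho : 'M[R[i]]_n -> 'M[R[i]]_m) : Prop := {
  rational_rep1 : rho 1%:M = 1%:M;
  rational_repM : forall g h, G g -> G h -> rho (g *m h) = rho g *m rho h;
  rational_rep_regular : forall i j, regular_fun G (fun g => rho g i j) }.

Definition stable_subspace (R : realType) (n : nat) (G : set 'M[R[i]]_n)
    (m : nat) (rho : 'M[R[i]]_n -> 'M[R[i]]_m) (U : {vspace 'cV[R[i]]_m}) : Prop :=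
  forall g u, G g -> u \in U -> rho g *m u \in U.

Definition completely_reducible (R : realType) (n : nat) (G : set 'M[R[i]]_n)
    (m : nat) (rho : 'M[R[i]]_n -> 'M[R[i]]_m) : Prop :=
  forall U : {vspace 'cV[R[i]]_m}, stable_subspace G rho U ->
  exists U' : {vspace 'cV[R[i]]_m},
    [/\ stable_subspace G rho U', (U + U' = fullv)%VS & (U :&: U' = 0)%VS].

(* Reductivity is defined by complete reducibility of all rational
   representations, as usual in invariant theory over C. *)
Definition reductive (R : realType) (n : nat) (G : set 'M[R[i]]_n) : Prop :=
  algebraic_group G /\
  forall (m : nat) (rho : 'M[R[i]]_n -> 'M[R[i]]_m),
    rational_rep G rho -> completely_reducible G rho.

Definition dsum_rep (R : realType) (n m k : nat)
    (rho : 'M[R[i]]_n -> 'M[R[i]]_m) (sigma : 'M[R[i]]_n -> 'M[R[i]]_k) :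
  'M[R[i]]_n -> 'M[R[i]]_(m + k) :=
  fun g => block_mx (rho g) 0 0 (sigma g).

Definition rep_orbit (R : realType) (n : nat) (G : set 'M[R[i]]_n) (m : nat)
    (rho : 'M[R[i]]_n -> 'M[R[i]]_m) (v : 'cV[R[i]]_m) : set 'cV[R[i]]_m :=
  [set rho g *m v | g in G].

Definition rep_stabilizer (R : realType) (n : nat) (G : set 'M[R[i]]_n) (m : nat)
    (rho : 'M[R[i]]_n -> 'M[R[i]]_m) (v : 'cV[R[i]]_m) : set 'M[R[i]]_n :=
  [set g | G g /\ rho g *m v = v].

Section Invariants.
Variables (R : realType) (n : nat) (G : set 'M[R[i]]_n).
Variables (m : nat) (rho : 'M[R[i]]_n -> 'M[R[i]]_m).

Definition is_invariant (f : {mpoly R[i][m]}) : Prop :=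
  forall g, G g -> forall x, peval f (rho g *m x) = peval f x.

Definition invariants : {pred {mpoly R[i][m]}} := fun f => `[< is_invariant f >].

Lemma invariants_subalg_closed : subalg_closed invariants.
Proof.
split=> [|a f h /asboolP invf /asboolP invh|f h /asboolP invf /asboolP invh].
- by apply/asboolP => g _ x; rewrite /peval !meval1.
- apply/asboolP => g Gg x; move: (invf g Gg x) (invh g Gg x).
  by rewrite /peval !mevalD !mevalZ => -> ->.
- apply/asboolP => g Gg x; move: (invf g Gg x) (invh g Gg x).
  by rewrite /peval !mevalM => -> ->.
Qed.

HB.instance Definition _ :=
  GRing.isSubalgClosed.Build R[i] {mpoly R[i][m]} invariants
    invariants_subalg_closed.

(* The invariant ring C[U]^G, as a C-algebra. *)
Record invring : Type := Invring {
  invring_poly :> {mpoly R[i][m]};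
  _ : invring_poly \in invariants }.

HB.instance Definition _ := [isSub for invring_poly].
HB.instance Definition _ := [Choice of invring by <:].
HB.instance Definition _ := [SubChoice_isSubAlgebra of invring by <:].

Definition homog_invariant (d : nat) (f : {mpoly R[i][m]}) : Prop :=
  is_invariant f /\ f \is d.-homog.

(* f lies in the C-subalgebra generated by S: it is a polynomial expression in
   finitely many elements of S. *)
Definition in_subalgebra (S : set {mpoly R[i][m]}) (f : {mpoly R[i][m]}) : Prop :=
  exists (k : nat) (t : k.-tuple {mpoly R[i][m]}) (p : {mpoly R[i][k]}),
    (forall i, S (tnth t i)) /\ f = p \mPo t.

Definition generated_in_degree (D : nat) : Prop :=
  forall f, is_invariant f ->
    in_subalgebra [set h | exists2 d, (d <= D)%N & homog_invariant d h] f.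

Definition null_cone : set 'cV[R[i]]_m :=
  zero_locus [set f | exists2 d, (0 < d)%N & homog_invariant d f].

Definition null_cone_cut_in_degree (D : nat) : Prop :=
  null_cone =
  zero_locus [set f | exists2 d, (1 <= d <= D)%N & homog_invariant d f].

End Invariants.

(* The least natural number satisfying P (0 if there is none; for the two uses
   below Hilbert's finiteness theorem ensures that there is one). *)
Definition least (P : nat -> Prop) : nat :=
  xget 0%N [set D | P D /\ forall D', P D' -> (D <= D')%N].

Definition beta (R : realType) (n : nat) (G : set 'M[R[i]]_n) (m : nat)
    (rho : 'M[R[i]]_n -> 'M[R[i]]_m) : nat :=
  least (generated_in_degree G rho).

Definition sigma (R : realType) (n : nat) (G : set 'M[R[i]]_n) (m : nat)
    (rho : 'M[R[i]]_n -> 'M[R[i]]_m) : nat :=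
  least (null_cone_cut_in_degree G rho).

(* msize is the degree plus one, and 0 for the zero polynomial. *)
Definition degree_nonincreasing (R : realType)
    (n : nat) (G : set 'M[R[i]]_n) (m : nat) (rho : 'M[R[i]]_n -> 'M[R[i]]_m)
    (n' : nat) (G' : set 'M[R[i]]_n') (m' : nat)
    (rho' : 'M[R[i]]_n' -> 'M[R[i]]_m')
    (phi : invring G rho -> invring G' rho') : Prop :=
  forall f, (msize (phi f) <= msize f)%N.

(* Main.v *)
(* The homomorphism is f |-> f(v, -).  It is onto because the orbit map
   G -> G.v is a quotient by H: every regular function on G which is invariant
   under right translation by H is a polynomial in the coordinates of g.v.  Then
   for h in C[W]^H the function (g.v, w) |-> h(g^-1 w) is a polynomial on the
   closed set G.v x W and, G being reductive, it extends to an invariant on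
   V + W.

   That H-invariant regular functions descend to G.v is where characteristic
   zero is used, in the following form.  By the Nullstellensatz f - f(g) is
   nilpotent on the scheme-theoretic fibre of the orbit map through g; let N be
   the maximal order of nilpotency over all invariant f.  Homogeneity of the
   orbit yields a linear form p over C[G.v], with values in C[G.v], which does
   not vanish on the (N-1)-st power of f - f(1) at 1.  The functions p(f^j) on the
   orbit satisfy the linear recurrence with characteristic polynomial (X - f)^N,
   whose coefficients, among them N f, are recovered by inverting a Hankel
   matrix; so f is locally, hence globally, a polynomial on the orbit.

   The bound for beta follows since C[V + W]^G is finitely generated.  For sigma
   one uses that, if w is a common zero of the H-invariants of degrees 1 to D,
   the homogeneous G-invariants of degree at most D are constant along the line
   (v, t w), and that some power of any other homogeneous invariant is a
   combination of those with invariant coefficients. *)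

Require Import Defs.
From HB Require Import structures.
From mathcomp Require Import all_boot all_order all_algebra.
From mathcomp Require Import boolp classical_sets reals.
From mathcomp Require Import complex mpoly.
From mathcomp Require Import ring lra zify.

Set Implicit Arguments.
Unset Strict Implicit.
Unset Printing Implicit Defensive.

Import Order.TTheory GRing.Theory Num.Theory.
Local Open Scope classical_set_scope.
Local Open Scope ring_scope.

(** * Ideals and Hilbert's basis theorem *)

Lemma nat_least (P : nat -> Prop) :
  (exists n, P n) -> exists n, P n /\ forall m, P m -> (n <= m)%N.
Proof.
move=> [n Pn]; pose p m := `[< P m >].
have ex : exists m, p m by exists n; apply/asboolP.
exists (ex_minn ex); case: ex_minnP => m /asboolP Pm minm; split=> // k Pk.
by apply: minm; apply/asboolP.
Qed.

(** Choosing, one step after another, an index that minimises [u] on the remaining tail yields the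
    subsequence. *)
Lemma nondecreasing_subseq (u : nat -> nat) :
  exists phi : nat -> nat, (forall i j, (i < j -> phi i < phi j)%N) /\
    forall i j, (i <= j -> u (phi i) <= u (phi j))%N.
Proof.
have am k : exists m, (k <= m)%N /\ forall j, (k <= j)%N -> (u m <= u j)%N.
  have [|n [[m [km <-]] minn]] :=
    @nat_least (fun x => exists m, (k <= m)%N /\ u m = x).
    by exists (u k), k.
  by exists m; split=> // j kj; apply: minn; exists j.
have [f /all_and2 [fge fmin]] := choice am.
pose phi := fix phi i := if i is j.+1 then f (phi j).+1 else f 0%N.
have phiS i : (phi i < phi i.+1)%N by exact: fge.
have phi_lt i j : (i < j -> phi i < phi j)%N by apply: (homo_ltn ltn_trans).
exists phi; split=> //; apply: (homo_leq leqnn leq_trans) => -[|i] //=.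
  by apply: fmin.
by apply: fmin; apply: leq_trans (phiS i) _; exact/ltnW/fge.
Qed.

(** Dickson's lemma: passing to a nondecreasing subsequence for each coordinate in turn makes any
    two remaining terms comparable. *)
Lemma dickson n (u : nat -> 'X_{1..n}) :
  exists i j, (i < j)%N /\ (u i <= u j)%MM.
Proof.
have [phi [phi_lt phi_le]] : exists phi : nat -> nat,
    (forall i j, (i < j -> phi i < phi j)%N) /\
    forall k, k \in enum 'I_n -> forall i j,
      (i <= j -> u (phi i) k <= u (phi j) k)%N.
  elim: (enum 'I_n) => [|k s [phi [phi_lt IH]]]; first by exists id.
  have [psi [psi_lt psi_le]] := nondecreasing_subseq (fun i => u (phi i) k).
  exists (phi \o psi); split=> [i j ij|l]; first exact/phi_lt/psi_lt.
  rewrite inE => /predU1P[-> i j|ls i j]; first exact: psi_le.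
  by rewrite leq_eqVlt => /predU1P[->//|/psi_lt/ltnW]; exact: IH.
exists (phi 0%N), (phi 1%N); split; first exact: phi_lt.
by apply/mnm_lepP => k; apply: phi_le; rewrite ?mem_enum.
Qed.

Record is_ideal (A : comNzRingType) (I : set A) : Prop := {
  ideal0 : I 0;
  idealD : forall x y, I x -> I y -> I (x + y);
  idealMl : forall a x, I x -> I (a * x) }.

Definition gen_ideal (A : comNzRingType) (s : seq A) : set A :=
  [set x | exists c : nat -> A, x = \sum_(i < size s) c i * s`_i].

Section Ideals.
Variable A : comNzRingType.
Implicit Types (I : set A) (s : seq A).

Lemma ideal_mulr I a x : is_ideal I -> I x -> I (x * a).
Proof. by move=> idI Ix; rewrite mulrC; apply: idealMl. Qed.

Lemma idealN I x : is_ideal I -> I x -> I (- x).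
Proof. by move=> idI Ix; rewrite -mulN1r; apply: idealMl. Qed.

Lemma idealB I x y : is_ideal I -> I x -> I y -> I (x - y).
Proof. by move=> idI Ix Iy; apply: idealD => //; apply: idealN. Qed.

Lemma ideal_sum I T (r : seq T) (P : pred T) (f : T -> A) :
  is_ideal I -> (forall i, P i -> I (f i)) -> I (\sum_(i <- r | P i) f i).
Proof.
by move=> idI If; apply: big_ind => //; [apply: ideal0 | apply: idealD].
Qed.

Lemma gen_ideal_ideal s : is_ideal (gen_ideal s).
Proof.
split=> [|x y [c ->] [d ->]|a x [c ->]].
- by exists (fun=> 0); rewrite big1 // => i _; rewrite mul0r.
- exists (fun i => c i + d i); rewrite -big_split.
  by apply: eq_bigr => i _; rewrite mulrDl.
- exists (fun i => a * c i); rewrite mulr_sumr.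
  by apply: eq_bigr => i _; rewrite mulrA.
Qed.

Lemma mem_gen_ideal s x : x \in s -> gen_ideal s x.
Proof.
move=> xs; exists (fun i => (i == index x s)%:R).
rewrite (bigD1 (Ordinal (etrans (index_mem x s) xs))) //= eqxx mul1r.
rewrite nth_index // big1 ?addr0 // => i.
by rewrite -val_eqE /= => /negbTE ->; rewrite mul0r.
Qed.

Lemma gen_ideal_sub s I : is_ideal I -> (forall x, x \in s -> I x) ->
  forall x, gen_ideal s x -> I x.
Proof.
move=> idI sI x [c ->]; apply: ideal_sum => // i _.
by apply: idealMl => //; apply/sI/mem_nth.
Qed.

Lemma gen_idealS s t : {subset s <= t} ->
  forall x, gen_ideal s x -> gen_ideal t x.
Proof.
move=> st; apply: gen_ideal_sub; first exact: gen_ideal_ideal.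
by move=> x xs; apply/mem_gen_ideal/st.
Qed.

(** In each term of the binomial expansion either y occurs to a power at least q or x to a power at
    least p. *)
Lemma ideal_exprD I x y p q : is_ideal I -> I (x ^+ p) -> I (y ^+ q) ->
  I ((x + y) ^+ (p + q)).
Proof.
move=> idI Ix Iy; rewrite exprDn; apply: ideal_sum => // i _.
rewrite -mulr_natl; apply: idealMl => //.
have [qi|iq] := leqP q i.
  by apply: idealMl => //; rewrite -(subnK qi) exprD; apply: idealMl.
apply: ideal_mulr => //.
suff -> : (p + q - i = p + (q - i))%N by rewrite exprD; apply: ideal_mulr.
by rewrite addnBA // ltnW.
Qed.

Lemma gen_ideal_expr I s p : is_ideal I -> (forall x, x \in s -> I (x ^+ p)) ->
  exists q, forall x, gen_ideal s x -> I (x ^+ q).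
Proof.
(* The summands are added one by one with [ideal_exprD]; the extra 1 serves the empty sum, since 0 ^
   0 = 1. *)
move=> idI sI; exists (p * size s).+1 => x [c ->].
suff H k : (k <= size s)%N -> I ((\sum_(i < k) c i * s`_i) ^+ (p * k).+1).
  exact: H.
elim: k => [|k IH] ks; first by rewrite big_ord0 expr0n /=; apply: ideal0.
rewrite big_ord_recr /= mulnS addnC -addSn; apply: ideal_exprD => //.
  by apply: IH; apply: ltnW.
by rewrite exprMn; apply: idealMl => //; apply/sI/mem_nth.
Qed.

End Ideals.

Section HilbertBasis.
Variables (F : fieldType) (n : nat).
Implicit Types (I : set {mpoly F[n]}) (s : seq {mpoly F[n]}).

(** Otherwise, adjoining again and again an element of [I] with least leading monomial among those
    not yet generated gives an infinite sequence [f]. By Dickson's lemma some leading monomial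
    divides a later one; cancelling the later one leaves an element of [I] that is still not
    generated but has a smaller leading monomial. *)
Lemma ideal_finite I : is_ideal I ->
  exists s, (forall x, x \in s -> I x) /\ forall x, I x -> gen_ideal s x.
Proof.
move=> idI; apply: contrapT => nofin.
(* [g s] has minimal leading monomial among the elements of I that are not
   generated by [s]. *)
have ex s : exists p, (forall x, x \in s -> I x) -> I p /\ ~ gen_ideal s p /\
    forall q, I q -> ~ gen_ideal s q -> (mlead p <= mlead q)%O.
  have [sI|nsI] := pselect (forall x, x \in s -> I x); last by exists 0 => /nsI.
  have [p [Ip np]] : exists p, I p /\ ~ gen_ideal s p.
    apply: contrapT => nex; apply: nofin; exists s; split=> // x Ix.
    by apply: contrapT => nx; apply: nex; exists x.
  move: {2}(mlead p) (erefl (mlead p)) => m; move: m p Ip np.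
  apply: ltmwf => m IH p Ip np pm.
  have [[q [Iq nq qp]]|nex] :=
    pselect (exists q, [/\ I q, ~ gen_ideal s q & (mlead q < mlead p)%O]).
    by apply: IH Iq nq erefl; rewrite -pm.
  exists p => _; split=> //; split=> // q Iq nq.
  by rewrite leNgt; apply/negP => qp; apply: nex; exists q.
have [g gP] := choice ex.
pose L := fix L k := if k is j.+1 then rcons (L j) (g (L j)) else [::].
have LI k x : x \in L k -> I x.
  elim: k x => [|k IH] x //=; rewrite mem_rcons inE => /predU1P[->|/IH//].
  by have [] := gP _ IH.
have LS j k : (j <= k)%N -> {subset L j <= L k}.
  elim: k => [|k IH]; first by rewrite leqn0 => /eqP ->.
  rewrite leq_eqVlt => /predU1P[->//|/IH sub] x /sub /= xL.
  by rewrite mem_rcons inE xL orbT.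
pose f k := g (L k).
have [i [j [ij uij]]] := dickson (fun k => mlead (f k)).
have [Ij [nj minj]] := gP _ (@LI j); rewrite -/(f j) in Ij nj minj.
have fi0 : f i != 0.
  apply/eqP => fi0; have [_ [+ _]] := gP _ (@LI i).
  by rewrite -/(f i) fi0 => nz; case: nz; exact: ideal0 (gen_ideal_ideal _).
have fj0 : f j != 0.
  by apply/eqP => fj0; apply: nj; rewrite fj0; exact: ideal0 (gen_ideal_ideal _).
have fiL : f i \in L j by apply: (LS i.+1) => //=; rewrite mem_rcons mem_head.
pose c := mleadc (f j) / mleadc (f i).
pose m := (mlead (f j) - mlead (f i))%MM.
have mfi0 : mleadc (f i) != 0 by rewrite mleadc_eq0.
have c0 : c != 0 by rewrite mulf_neq0 ?invr_eq0 ?mleadc_eq0.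
pose t := c *: 'X_[m] * f i.
have X0 : c *: 'X_[m] != 0 :> {mpoly F[n]}.
  rewrite -mul_mpolyC mulf_neq0 ?mpolyC_eq0 // -msize_poly_eq0 msizeX //.
have tlead : mlead t = mlead (f j).
  by rewrite mleadM // mleadZ // mleadXm submK.
have Xc : mleadc (c *: 'X_[m] : {mpoly F[n]}) = c.
  by rewrite mleadZ // mleadXm mcoeffZ mcoeffX eqxx mulr1.
have tleadc : mleadc t = mleadc (f j).
  rewrite mleadcM_proper Xc; [exact: divfK | exact: mulf_neq0].
pose q := f j - t.
have Gt : gen_ideal (L j) t.
  by apply: idealMl; [apply: gen_ideal_ideal | apply: mem_gen_ideal].
have nq : ~ gen_ideal (L j) q.
  move=> Gq; apply: nj; rewrite -(subrK t (f j)).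
  by apply: idealD => //; apply: gen_ideal_ideal.
have Iq : I q.
  by apply: idealB => //; apply: idealMl => //; exact: LI fiL.
have q0 : q != 0.
  by apply/eqP => q0; apply: nq; rewrite q0; exact: ideal0 (gen_ideal_ideal _).
have := minj q Iq nq.
have qle : (mlead q <= mlead (f j))%O.
  by apply: le_trans (mleadB_le _ _) _; rewrite tlead joinxx.
move=> qge; have qlead : mlead q = mlead (f j).
  by apply/eqP; rewrite eq_le qle qge.
have : mleadc q = 0.
  by rewrite qlead /q mcoeffB -{2}tlead tleadc subrr.
by apply/eqP; rewrite mleadc_eq0.
Qed.

(** The ideal generated by [S] has finitely many generators, and each of them involves only finitely
    many elements of [S]; these are collected. *)
Lemma hilbert_basis (S : set {mpoly F[n]}) :
  exists s, (forall x, x \in s -> S x) /\ forall x, S x -> gen_ideal s x.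
Proof.
pose I : set {mpoly F[n]} :=
  [set x | exists s, (forall y, y \in s -> S y) /\ gen_ideal s x].
have idI : is_ideal I.
  split=> [|x y [s [sS sx]] [t [tS ty]]|a x [s [sS sx]]].
  - by exists [::]; split=> //; exact: ideal0 (gen_ideal_ideal _).
  - exists (s ++ t); split=> [z|].
      by rewrite mem_cat => /orP[/sS|/tS].
    apply: idealD; first exact: gen_ideal_ideal.
      by apply: gen_idealS sx => z zs; rewrite mem_cat zs.
    by apply: gen_idealS ty => z zs; rewrite mem_cat zs orbT.
  - by exists s; split=> //; apply: idealMl => //; apply: gen_ideal_ideal.
have [s [sI Is]] := ideal_finite idI.
have [t [tS st]] : exists t, (forall y, y \in t -> S y) /\
    forall x, x \in s -> gen_ideal t x.
  elim: s sI {Is} => [|x s IH] sI; first by exists [::].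
  have [|t [tS st]] := IH.
    by move=> y ys; apply: sI; rewrite inE ys orbT.
  have [u [uS ux]] := sI x (mem_head _ _).
  exists (t ++ u); split=> [z|z]; first by rewrite mem_cat => /orP[/tS|/uS].
  rewrite inE => /predU1P[->|/st].
    by apply: gen_idealS ux => y yu; rewrite mem_cat yu orbT.
  by apply: gen_idealS => y yu; rewrite mem_cat yu.
exists t; split=> // x Sx.
apply: (gen_ideal_sub (gen_ideal_ideal t) st); apply: Is; exists [:: x].
by split=> [y|]; [rewrite inE => /eqP -> | apply/mem_gen_ideal/mem_head].
Qed.

End HilbertBasis.

(** * Hilbert's Nullstellensatz *)

Lemma bounded_uniq_finite (T : eqType) (P : T -> Prop) (N : nat) :
  ~ (exists s : seq T, [/\ uniq s, size s = N & forall x, x \in s -> P x]) ->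
  exists s : seq T, forall x, P x -> x \in s.
Proof.
move=> nN; have [[|M] [nM minM]] := nat_least (ex_intro
  (fun N => ~ exists s, [/\ uniq s, size s = N & forall x, x \in s -> P x]) N nN).
  by case: nM; exists [::].
have [s [us sM sP]] : exists s, [/\ uniq s, size s = M & forall x, x \in s -> P x].
  by apply: contrapT => /minM; rewrite ltnn.
exists s => x Px; apply: contrapT => /negP xs; apply: nM; exists (x :: s).
split; rewrite /= ?xs ?sM // => y; rewrite inE => /predU1P[->//|]; exact: sP.
Qed.

Lemma subinterval_avoiding (R : realType) (s : seq R) (a b : R) : a < b ->
  exists c d : R, [/\ a <= c, c < d, d <= b &
    forall x, x \in s -> ~~ (c <= x <= d)].
Proof.
move=> ab; elim: s => [|y s [c [d [ac cd db sP]]]]; first by exists a, b.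
have [yl|yr] := lerP y ((c + d) / 2).
  exists ((c + 3 * d) / 4), d; split=> //; [lra|lra|].
  move=> x; rewrite inE => /predU1P[->|/sP].
    by apply/negP => /andP[? _]; lra.
  by apply: contra => /andP[? ->]; rewrite andbT; lra.
exists c, ((c + d) / 2); split=> //; [lra|lra|].
move=> x; rewrite inE => /predU1P[->|/sP].
  by apply/negP => /andP[_ ?]; lra.
by apply: contra => /andP[-> ?] /=; lra.
Qed.

(** A form of the uncountability of the reals: if all fibres were finite, nested intervals, each
    step avoiding one more fibre, would have a common point that lies in no fibre. *)
Lemma real_pigeonhole (R : realType) (T : countType) (f : R -> T) :
  exists t, forall N, exists s : seq R,
    [/\ uniq s, size s = N & forall x, x \in s -> f x = t].
Proof.
apply: contrapT => nex.
have fin t : exists s : seq R, forall x, f x = t -> x \in s.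
  have [N nN] : exists N, ~ exists s : seq R,
      [/\ uniq s, size s = N & forall x, x \in s -> f x = t].
    apply: contrapT => nN; apply: nex; exists t => N.
    by apply: contrapT => nN'; apply: nN; exists N.
  exact: bounded_uniq_finite nN.
have {fin} [E EP] := choice fin.
pose E' k : seq R := if unpickle k is Some t then E t else [::].
have step (z : R * R * nat) : exists w : R * R, z.1.1 < z.1.2 ->
    [/\ z.1.1 <= w.1, w.1 < w.2, w.2 <= z.1.2 &
      forall x, x \in E' z.2 -> ~~ (w.1 <= x <= w.2)].
  have [lt|] := boolP (z.1.1 < z.1.2); last by exists (0, 0).
  by have [c [d H]] := subinterval_avoiding (E' z.2) lt; exists (c, d).
have {step} [g gP] := choice step.
pose I := fix I k : R * R := if k is j.+1 then g (I j, j) else (0, 1).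
have I_lt k : (I k).1 < (I k).2.
  by elim: k => [|k /(gP (_, k))[]] //=; apply: ltr01.
have I_step k := gP (I k, k) (I_lt k).
have I1 j k : (j <= k)%N -> (I j).1 <= (I k).1.
  apply: (homo_leq (f := fun k => (I k).1) lexx le_trans) => i.
  by have [] := I_step i.
have I2 j k : (j <= k)%N -> (I k).2 <= (I j).2.
  apply: (homo_leq (f := fun k => (I k).2) (r := fun x y => y <= x)) => //.
    by move=> y x z xy yz; apply: le_trans yz xy.
  by move=> i; have [] := I_step i.
have I12 j k : (I j).1 <= (I k).2.
  have [jk|/ltnW kj] := leqP j k.
    exact/ltW/(le_lt_trans (I1 _ _ jk))/I_lt.
  exact/ltW/(lt_le_trans (I_lt j))/I2.
pose S := [set (I k).1 | k in [set: nat]].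
have xP k : (I k).1 <= sup S <= (I k).2.
  apply/andP; split.
    apply: ub_le_sup; last by exists k.
    by exists (I 0%N).2 => _ [j _ <-].
  by apply: ge_sup; [exists (I 0%N).1, 0%N | move=> _ [j _ <-]].
have [_ _ _ /(_ (sup S))] := I_step (pickle (f (sup S))).
have -> : (g (I (pickle (f (sup S))), pickle (f (sup S)))) =
  I (pickle (f (sup S))).+1 by [].
by rewrite xP /E' pickleK => /(_ (EP _ _ erefl)).
Qed.

(** There are more polynomials than monomials, so the coefficient matrix has a nonzero vector in its
    left kernel. *)
Lemma mpoly_dependent (F : fieldType) n d r (p : 'I_r -> {mpoly F[n]}) :
  (forall j, msize (p j) <= d)%N -> (#|{: 'X_{1..n < d}}| < r)%N ->
  exists c : 'I_r -> F, (exists j, c j != 0) /\ \sum_j c j *: p j = 0.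
Proof.
move=> pd rd.
pose M := \matrix_(j < r, l < #|{: 'X_{1..n < d}}|) (p j)@_(enum_val l).
have : kermx M != 0.
  rewrite kermx_eq0 /row_free neq_ltn; apply/orP; left.
  exact: leq_ltn_trans (rank_leq_col _) rd.
rewrite -nz_row_eq0 => v0; pose v := nz_row (kermx M).
have vM : v *m M = 0 by apply/sub_kermxP/nz_row_sub.
exists (fun j => v 0 j); split.
  by have /rV0Pn[j vj] := v0; exists j.
apply/mpolyP => m; rewrite linear_sum mcoeff0 /=.
have [md|md] := ltnP (mdeg m) d; last first.
  apply: big1 => j _; rewrite mcoeffZ memN_msupp_eq0 ?mulr0 //.
  by apply: msize_mdeg_ge; apply: leq_trans md.
have := congr1 (fun A : 'rV_ _ => A 0 (enum_rank (BMultinom md))) vM.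
rewrite !mxE => vM0; rewrite -[RHS]vM0; apply: eq_bigr => j _.
by rewrite mcoeffZ mxE enum_rankK.
Qed.

Section Nullstellensatz.
Variables (R : realType) (n : nat).
Local Notation C := R[i].
Local Notation A := {mpoly C[n]}.
Implicit Types (I Q : set A) (k : A).

Let avoids k Q := forall s, ~ Q (k ^+ s).

Lemma maximal_avoiding I k : is_ideal I -> avoids k I ->
  exists Q, [/\ is_ideal Q, I `<=` Q, avoids k Q &
    forall Q', is_ideal Q' -> Q `<=` Q' -> avoids k Q' -> Q' `<=` Q].
Proof.
move=> idI kI.
(* Taking the union with [I] lets the empty chain, whose union is the empty set, satisfy the
   hypothesis of Zorn's lemma. *)
pose P Q := is_ideal (Q `|` I) /\ avoids k (Q `|` I).
have [|Q [[idQ kQ] maxQ]] := @Zorn_bigcup A P.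
  move=> F FP tot.
  have bigP x y : (\bigcup_(X in F) X `|` I) x -> (\bigcup_(X in F) X `|` I) y ->
      exists Q, [/\ is_ideal Q, avoids k Q, Q x, Q y & Q `<=` \bigcup_(X in F) X `|` I].
    have sub X : F X -> X `|` I `<=` \bigcup_(X in F) X `|` I.
      by move=> FX z [Xz|Iz]; [left; exists X | right].
    move=> [[X FX Xx]|Ix] [[Y FY Yy]|Iy].
    - have [XY|YX] := tot X Y FX FY.
        exists (Y `|` I); have [? ?] := FP Y FY.
        by split=> //; [left; apply: XY | left | apply: sub].
      exists (X `|` I); have [? ?] := FP X FX.
      by split=> //; [left | left; apply: YX | apply: sub].
    - exists (X `|` I); have [? ?] := FP X FX.
      by split=> //; [left | right | apply: sub].
    - exists (Y `|` I); have [? ?] := FP Y FY.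
      by split=> //; [right | left | apply: sub].
    - by exists I; split=> // z; right.
  split=> [|s kx]; last by have [Q [_ kQ /kQ]] := bigP _ _ kx kx.
  split=> [|x y x_in y_in|a x x_in]; first by right; apply: ideal0.
    by have [Q [idQ _ Qx Qy]] := bigP _ _ x_in y_in; apply; apply: idealD.
  by have [Q [idQ _ Qx _]] := bigP _ _ x_in x_in; apply; apply: idealMl.
exists (Q `|` I); split=> //.
move=> Q' idQ' QQ' kQ' x Q'x; apply: contrapT => nx.
have IQ' : Q' `|` I = Q' by rewrite setUidl // => y Iy; apply: QQ'; right.
apply: (maxQ Q'); last by rewrite /P IQ'.
split=> [y Qy|Q'Q]; first by apply: QQ'; left.
by apply: nx; left; apply: Q'Q.
Qed.

(** For x outside [Q], maximality puts a power of [k] into Q + (x), so x becomes invertible modulo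
    [Q] once [k] is inverted. Multiplying two such congruences gives primality. *)
Lemma avoiding_prime Q k :
  is_ideal Q -> avoids k Q ->
  (forall Q', is_ideal Q' -> Q `<=` Q' -> avoids k Q' -> Q' `<=` Q) ->
  (forall x, ~ Q x -> exists s a, Q (k ^+ s - a * x)) /\
  (forall x y, Q (x * y) -> Q x \/ Q y).
Proof.
move=> idQ kQ maxQ.
have H x : ~ Q x -> exists s a, Q (k ^+ s - a * x).
  move=> nx; apply: contrapT => nex.
  pose Q' : set A := [set y | exists a, Q (y - a * x)].
  have idQ' : is_ideal Q'.
    split=> [|y z [a ya] [b zb]|c y [a ya]].
    - by exists 0; rewrite mul0r subr0; apply: ideal0.
    - exists (a + b); have -> : y + z - (a + b) * x = y - a * x + (z - b * x).
        by ring.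
      exact: idealD.
    - exists (c * a); have -> : c * y - c * a * x = c * (y - a * x) by ring.
      exact: idealMl.
  apply: nx; apply: (maxQ Q') => //.
  - by move=> y Qy; exists 0; rewrite mul0r subr0.
  - by move=> s [a Qa]; apply: nex; exists s, a.
  - by exists 1; rewrite mul1r subrr; apply: ideal0.
split=> // x y Qxy; have [?|nx] := pselect (Q x); first by left.
have [?|ny] := pselect (Q y); first by right.
have [s [a Qa]] := H _ nx; have [t [b Qb]] := H _ ny.
case: (kQ (s + t)%N); rewrite exprD.
have -> : k ^+ s * k ^+ t = (k ^+ t) * (k ^+ s - a * x) +
    (a * x) * (k ^+ t - b * y) + (a * b) * (x * y) by ring.
by apply: idealD => //; [apply: idealD => //|]; apply: idealMl.
Qed.

(** Otherwise, for every real a, some power of [k] is congruent modulo [Q] to a multiple of X_i - a.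
    By uncountability, arbitrarily many a share the exponent and the degree of the cofactor; enough
    cofactors are linearly dependent. This produces a nonzero polynomial q in one variable with k^s
    q(X_i) in [Q], and since [Q] is prime and the field algebraically closed, a linear factor of
    q(X_i) lies in [Q]. *)
Lemma avoiding_linear Q k (i : 'I_n) :
  is_ideal Q -> avoids k Q ->
  (forall Q', is_ideal Q' -> Q `<=` Q' -> avoids k Q' -> Q' `<=` Q) ->
  exists a : C, Q ('X_i - a%:MP).
Proof.
move=> idQ kQ maxQ; have [inv prime] := avoiding_prime idQ kQ maxQ.
apply: contrapT => nex.
have ex (a : R) : exists z : nat * A, Q (k ^+ z.1 - z.2 * ('X_i - (a%:C%C)%:MP)).
  have [|s [b]] := inv ('X_i - (a%:C%C)%:MP); first by move=> Qa; apply: nex; exists a%:C%C.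
  by exists (s, b).
have {ex} [f fP] := choice ex.
have [[s d] /(_ #|{: 'X_{1..n < d}}|.+1) [as_ [uas sas asP]]] :=
  real_pigeonhole (fun a => ((f a).1, msize (f a).2)).
pose a (j : 'I_(#|{: 'X_{1..n < d}}|.+1)) : R := as_`_j.
have am j : a j \in as_ by rewrite mem_nth ?sas.
have ainj : injective a.
  move=> j l /eqP; rewrite nth_uniq ?sas // => /eqP; exact: val_inj.
pose p j := (f (a j)).2.
have pP j : Q (k ^+ s - p j * ('X_i - ((a j)%:C%C)%:MP)).
  by have := fP (a j); have /= [-> _] := asP _ (am j).
have [|c [[j0 cj0] sum0]] := @mpoly_dependent _ _ d _ p _ (ltnSn _).
  by move=> j; rewrite /p; have /= [_ ->] := asP _ (am j).
(* The numerator of the sum of the fractions c_j / (X - a_j) over their common denominator; it does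
   not vanish at a_j when c_j is nonzero. *)
pose q : {poly C} := \sum_j c j *: \prod_(l | l != j) ('X - ((a l)%:C%C)%:P).
pose ev (u : {poly C}) : A := (map_poly (@mpolyC n C) u).['X_i].
have evM u w : ev (u * w) = ev u * ev w by rewrite /ev rmorphM hornerM.
have evD u w : ev (u + w) = ev u + ev w by rewrite /ev rmorphD hornerD.
have evC b : ev b%:P = b%:MP by rewrite /ev map_polyC hornerC.
have evL b : ev ('X - b%:P) = 'X_i - b%:MP.
  by rewrite /ev rmorphB /= map_polyX map_polyC hornerD hornerN hornerX hornerC.
have q0 : q != 0.
  apply/eqP => /(congr1 (fun u : {poly C} => u.[(a j0)%:C%C])).
  rewrite horner0 horner_sum (bigD1 j0) //= [X in _ + X]big1 ?addr0 => [|j jj0].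
    move/eqP; rewrite hornerZ mulf_eq0 (negbTE cj0) /= horner_prod.
    apply/negP/prodf_neq0 => l lj0.
    rewrite hornerXsubC subr_eq0; apply: contra lj0 => /eqP E.
    by apply/eqP/ainj; have /complexI := E.
  by rewrite hornerZ horner_prod (bigD1 j0) 1?eq_sym //= hornerXsubC subrr mul0r mulr0.
(* Since k^s is congruent to p_j (X_i - a_j) for every j, k^s q(X_i) is congruent to the product of
   all X_i - a_l times the sum of the c_j p_j, which is 0. *)
have Qq : Q (k ^+ s * ev q).
  have -> : k ^+ s * ev q = \sum_j (c j)%:MP * ev (\prod_(l | l != j) ('X - ((a l)%:C%C)%:P)) *
      (k ^+ s - p j * ('X_i - ((a j)%:C%C)%:MP)).
    under eq_bigr => j _ do rewrite mulrBr.
    rewrite sumrB.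
    have -> : \sum_j (c j)%:MP * ev (\prod_(l | l != j) ('X - ((a l)%:C%C)%:P)) *
        (p j * ('X_i - ((a j)%:C%C)%:MP)) =
        ev (\prod_l ('X - ((a l)%:C%C)%:P)) * \sum_j c j *: p j.
      rewrite mulr_sumr; apply: eq_bigr => j _.
      by rewrite [in RHS](bigD1 j) //= evM evL -mul_mpolyC; ring.
    rewrite sum0 mulr0 subr0 -mulr_suml mulrC; congr (_ * _).
    rewrite /q; elim/big_rec2: _ => [|j u w _ IH]; first by rewrite -polyC0 evC.
    by rewrite evD IH -mul_polyC evM evC.
  by apply: ideal_sum => // j _; apply: idealMl.
have [/kQ//|] := prime _ _ Qq.
have [r ->] := closed_field_poly_normal q.
rewrite -mul_polyC evM evC => /prime[Qc|].
  apply: (kQ 0%N); rewrite expr0.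
  have -> : 1 = (lead_coef q)^-1%:MP * (lead_coef q)%:MP :> A.
    by rewrite -mpolyCM mulVf ?lead_coef_eq0.
  exact: idealMl.
elim: r => [|b r IH].
  by rewrite big_nil -polyC1 evC => /(kQ 0%N).
rewrite big_cons evM evL => /prime[Qb|//].
by apply: nex; exists b.
Qed.

Lemma mpoly_sub_meval Q (a : 'I_n -> C) : is_ideal Q ->
  (forall i, Q ('X_i - (a i)%:MP)) -> forall p : A, Q (p - p.@[a]%:MP).
Proof.
move=> idQ Qa; have QX m : Q ('X_[m] - ('X_[m] : A).@[a]%:MP).
  rewrite mpolyXE_id.
  elim/big_rec: _ => [|i p _ IH].
    by rewrite meval1 subrr; apply: ideal0.
  have : forall q : A, Q (q - q.@[a]%:MP) -> Q ('X_i * q - ('X_i * q).@[a]%:MP).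
    move=> q Qq; rewrite mevalM mevalXU mpolyCM.
    have -> : 'X_i * q - (a i)%:MP * q.@[a]%:MP = 'X_i * (q - q.@[a]%:MP) +
      q.@[a]%:MP * ('X_i - (a i)%:MP) by ring.
    by apply: idealD => //; apply: idealMl.
  move=> H; elim: (m i) => [|e IHe]; first by rewrite expr0 mul1r.
  by rewrite exprS -mulrA; apply: H.
elim/mpolyind => [|c m p _ _ IH]; first by rewrite meval0 subrr; apply: ideal0.
rewrite mevalD mevalZ mpolyCD mpolyCM -mul_mpolyC.
have -> : c%:MP * 'X_[m] + p - (c%:MP * 'X_[m].@[a]%:MP + p.@[a]%:MP) =
  c%:MP * ('X_[m] - ('X_[m] : A).@[a]%:MP) + (p - p.@[a]%:MP) by ring.
by apply: idealD => //; apply: idealMl.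
Qed.

(** If [I] contains no power of [k], enlarge it to a maximal such ideal [Q]. It contains X_i - a_i
    for every i, so every polynomial is congruent to its value at a. Hence a is a zero of [I], and
    k(a) = 0 would put [k] into [Q]. *)
Lemma nullstellensatz I k : is_ideal I ->
  (forall a, (forall p, I p -> p.@[a] = 0) -> k.@[a] = 0) ->
  exists s, I (k ^+ s).
Proof.
move=> idI kI; apply: contrapT => nex.
have [|Q [idQ IQ kQ maxQ]] := @maximal_avoiding I k idI.
  by move=> s Is; apply: nex; exists s.
have [a aP] := choice (fun i => avoiding_linear i idQ kQ maxQ).
have Qsub := mpoly_sub_meval idQ aP.
have val0 p : Q p -> p.@[a] = 0.
  move=> Qp; apply/eqP; apply: contrapT => /negP p0; apply: (kQ 0%N).
  have -> : k ^+ 0 = p.@[a]^-1%:MP * (p - (p - p.@[a]%:MP)).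
    by rewrite opprB addrC subrK -mpolyCM mulVf.
  by apply: idealMl => //; apply: idealB.
apply: (kQ 1%N); rewrite expr1 -[k](subrK k.@[a]%:MP) kI ?mpolyC0.
  by rewrite addr0; have := Qsub k; rewrite kI // => p /IQ/val0.
by move=> p /IQ/val0.
Qed.

(** The Nullstellensatz for the zero ideal makes p - q nilpotent. *)
Lemma meval_inj (p q : A) : (forall a, p.@[a] = q.@[a]) -> p = q.
Proof.
move=> pq; have [| |s] := @nullstellensatz [set 0] (p - q).
- by split=> [|x y -> ->|a x ->] //=; rewrite ?addr0 ?mulr0.
- by move=> a _; rewrite mevalB pq subrr.
by move=> /= /eqP; rewrite expf_eq0 subr_eq0 => /andP[_ /eqP].
Qed.

End Nullstellensatz.

(** * Spaces of functions *)

Lemma nat_greatest (P : nat -> Prop) b :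
  (exists n, P n) -> (forall n, P n -> (n <= b)%N) ->
  exists n, P n /\ forall m, P m -> (m <= n)%N.
Proof.
move=> [n Pn] Pb; pose p m := `[< P m >].
have ex : exists m, p m by exists n; apply/asboolP.
have pb m : p m -> (m <= b)%N by move=> /asboolP/Pb.
exists (ex_maxn ex pb); case: ex_maxnP => m /asboolP Pm maxm; split=> // k Pk.
by apply: maxm; apply/asboolP.
Qed.

(** A subspace of maximal dimension inside [P] exhausts [P], since a missing vector could be
    adjoined to it. *)
Lemma vspace_of_set (F : fieldType) (V : vectType F) (P : set V) :
  P 0 -> (forall a u w, P u -> P w -> P (a *: u + w)) ->
  exists U : {vspace V}, forall u, u \in U <-> P u.
Proof.
move=> P0 PL; pose Q d := exists U : {vspace V}, \dim U = d /\ forall u, u \in U -> P u.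
have [||d [[U [<- UP]] maxU]] := @nat_greatest Q (\dim {:V}).
- by exists 0%N, 0%VS; rewrite dimv0; split=> // u; rewrite memv0 => /eqP ->.
- by move=> _ [U [<- _]]; apply/dimvS/subvf.
exists U => u; split; first exact: UP.
move=> Pu; apply: contrapT => /negP uU.
have : Q (\dim (U + <[u]>)).
  exists (U + <[u]>)%VS; split=> // _ /memv_addP[w wU [_ /vlineP[c ->] ->]].
  by rewrite addrC; apply: PL => //; apply: UP.
move=> /maxU; rewrite leqNgt => /negP; apply.
rewrite ltn_neqAle dimvS ?addvSl // andbT; apply: contra uU => /eqP dimE.
have /eqP -> : U == (U + <[u]>)%VS by rewrite eqEdim addvSl /= dimE.
by have := memv_add (mem0v U) (memv_line u); rewrite add0r.
Qed.

Record is_subspace (F : fieldType) (S : Type) (X : set (S -> F)) : Prop := {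
  subspace0 : X (fun=> 0);
  subspaceP : forall a u w, X u -> X w -> X (fun s => a * u s + w s) }.

Section Subspaces.
Variables (F : fieldType) (S : Type) (X : set (S -> F)).
Hypothesis subX : is_subspace X.

Lemma subspace_ext u w : u =1 w -> X u -> X w.
Proof. by move=> /funext ->. Qed.

Lemma subspaceD u w : X u -> X w -> X (fun s => u s + w s).
Proof.
move=> Xu Xw; apply: subspace_ext (subspaceP subX 1 Xu Xw) => s.
by rewrite mul1r.
Qed.

Lemma subspaceZ a u : X u -> X (fun s => a * u s).
Proof.
move=> Xu; apply: subspace_ext (subspaceP subX a Xu (subspace0 subX)) => s.
by rewrite addr0.
Qed.

Lemma subspaceB u w : X u -> X w -> X (fun s => u s - w s).
Proof.
move=> Xu Xw; apply: subspace_ext (subspaceP subX (-1) Xw Xu) => s.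
by rewrite mulN1r addrC.
Qed.

Lemma subspace_sum (T : Type) (r : seq T) (c : T -> F) (y : T -> S -> F) :
  (forall k, X (y k)) -> X (fun s => \sum_(k <- r) c k * y k s).
Proof.
move=> Xy; elim: r => [|k r IH].
  by apply: subspace_ext (subspace0 subX) => s; rewrite big_nil.
apply: subspace_ext (subspaceP subX (c k) (Xy k) IH) => s.
by rewrite big_cons.
Qed.

End Subspaces.

(** Function spaces get bases dual to evaluation at points, so that coordinates are values. A dual
    system of maximal size spans on [D], because the error of interpolating a function, if nonzero
    at a point of [D], would extend the system; sizes are bounded by a rank argument. *)
Lemma interpolation_basis (F : fieldType) (S : Type) (D : set S)
    (X : set (S -> F)) (J : finType) (x : J -> S -> F) :
  is_subspace X ->
  (forall u, X u -> exists c : J -> F, forall s, D s -> u s = \sum_j c j * x j s) ->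
  exists r (y : 'I_r -> S -> F) (t : 'I_r -> S),
    [/\ forall k, X (y k), forall k, D (t k),
        forall k l, y k (t l) = (k == l)%:R &
        forall u, X u -> forall s, D s -> u s = \sum_k u (t k) * y k s].
Proof.
move=> subX finX.
pose P r := exists (y : 'I_r -> S -> F) (t : 'I_r -> S),
  [/\ forall k, X (y k), forall k, D (t k) & forall k l, y k (t l) = (k == l)%:R].
have [||r [[y [t [Xy Dt yt]]] maxr]] := @nat_greatest P #|J|.
- by exists 0%N, (fun i s => 0), (fun i : 'I_0 => False_rect S (ltac:(by case: i))); split=> -[].
- move=> r [y [t [Xy Dt yt]]].
  have [c cP] := choice (fun k => finX _ (Xy k)).
  have E : (\matrix_(k < r, j < #|J|) c k (enum_val j)) *m
      (\matrix_(j < #|J|, l < r) x (enum_val j) (t l)) = 1%:M.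
    apply/matrixP => k l; rewrite !mxE -yt cP //.
    rewrite (reindex (@enum_val J J)) /=; last first.
      by exists enum_rank => j _; rewrite ?enum_valK ?enum_rankK.
    by apply: eq_bigr => j _; rewrite !mxE.
  by rewrite -[leqLHS](mxrank1 F) -E; apply: leq_trans (mxrankM_maxl _ _) (rank_leq_col _).
exists r, y, t; split=> // u Xu s Ds.
apply: contrapT => /eqP nu.
pose w s := u s - \sum_k u (t k) * y k s.
have Xw : X w by apply: subspaceB => //; apply: subspace_sum.
have wt l : w (t l) = 0.
  rewrite /w (bigD1 l) //= yt eqxx mulr1 big1 ?addr0 ?subrr // => k kl.
  by rewrite yt (negbTE kl) mulr0.
have ws : w s != 0 by rewrite subr_eq0.
pose z s' := (w s)^-1 * w s'.
have Xz : X z by apply: subspaceZ.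
have zs : z s = 1 by rewrite /z mulVf.
have zt l : z (t l) = 0 by rewrite /z wt mulr0.
suff /maxr : P r.+1 by rewrite ltnn.
exists (fun k => if unlift ord_max k is Some j
                 then fun s' => y j s' - y j s * z s' else z).
exists (fun k => if unlift ord_max k is Some j then t j else s).
split=> [k|k|k l].
- by case: unliftP => // j _; apply: subspaceB => //; apply: subspaceZ.
- by case: unliftP.
- case: unliftP => [j ->|->]; case: unliftP => [i ->|->].
  + by rewrite zt mulr0 subr0 yt (inj_eq lift_inj).
  + by rewrite zs mulr1 subrr eq_sym (negbTE (neq_lift _ _)).
  + by rewrite zt (negbTE (neq_lift _ _)).
  + by rewrite zs eqxx.
Qed.

(** * Degree bounds under polynomial substitution *)

Section PolynomialSubstitution.
Variables (F : fieldType).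

Lemma msizeM_pred_le n (p q : {mpoly F[n]}) :
  (msize (p * q) <= (msize p + msize q).-1)%N.
Proof.
have [->|p0] := eqVneq p 0; first by rewrite mul0r msize0.
have [->|q0] := eqVneq q 0; first by rewrite mulr0 msize0.
by rewrite msizeM.
Qed.

Lemma msize_prod_le n (I : Type) (r : seq I) (f : I -> {mpoly F[n]}) (e : I -> nat) :
  (forall i, msize (f i) <= (e i).+1)%N ->
  (msize (\prod_(i <- r) f i) <= (\sum_(i <- r) e i).+1)%N.
Proof.
move=> fe; elim: r => [|i r IH]; first by rewrite !big_nil msize1.
rewrite !big_cons; apply: leq_trans (msizeM_pred_le _ _) _.
have := fe i; lia.
Qed.

Lemma msize_exp_le n (f : {mpoly F[n]}) d e : (msize f <= d.+1)%N ->
  (msize (f ^+ e) <= (d * e).+1)%N.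
Proof.
move=> fd; elim: e => [|e IH]; first by rewrite expr0 msize1.
rewrite exprS; apply: leq_trans (msizeM_pred_le _ _) _; lia.
Qed.

Lemma msize_comp_le n k d e (p : {mpoly F[n]}) (t : n.-tuple {mpoly F[k]}) :
  (msize p <= e.+1)%N -> (forall i, msize (tnth t i) <= d.+1)%N ->
  (msize (p \mPo t) <= (d * e).+1)%N.
Proof.
move=> pe td; rewrite comp_mpolyEX big_seq; apply: leq_trans (msize_sum _ _ _) _.
apply/bigmax_leqP_seq => m _ mp; apply: leq_trans (msizeZ_le _ _) _.
have me : (mdeg m <= e)%N by rewrite -ltnS (leq_trans (msize_mdeg_lt mp)).
apply: (@leq_trans (d * mdeg m).+1); last by rewrite ltnS leq_mul2l me orbT.
rewrite mdegE comp_mpolyX big_distrr.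
by apply: msize_prod_le => i; apply/msize_exp_le/td.
Qed.

Lemma msize_comp_affine n k (p : {mpoly F[n]}) (t : n.-tuple {mpoly F[k]}) :
  (forall i, msize (tnth t i) <= 2)%N -> (msize (p \mPo t) <= msize p)%N.
Proof.
move=> t2; have [->|p0] := eqVneq p 0; first by rewrite comp_mpoly0 !msize0.
rewrite [leqRHS]mpolySpred // -[X in (_ <= X.+1)%N]mul1n.
by apply: msize_comp_le => //; rewrite -mpolySpred.
Qed.

Lemma msize_affine n (c : F) (a : 'I_n -> F) :
  (msize (c%:MP + \sum_i a i *: 'X_i : {mpoly F[n]}) <= 2)%N.
Proof.
apply: leq_trans (msizeD_le _ _) _; rewrite geq_max msizeC.
rewrite (leq_trans (leq_b1 _)) //=; apply: leq_trans (msize_sum _ _ _) _.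
apply/bigmax_leqP_seq => i _ _; apply: leq_trans (msizeZ_le _ _) _.
by rewrite msizeX mdeg1.
Qed.

Lemma affine_substitution n k (c : 'I_n -> F) (a : 'I_n -> 'I_k -> F) (p : {mpoly F[n]}) :
  exists q : {mpoly F[k]}, (msize q <= msize p)%N /\
    forall z, q.@[z] = p.@[fun i => c i + \sum_j a i j * z j].
Proof.
pose t := [tuple (c i)%:MP + \sum_j a i j *: 'X_j | i < n].
exists (p \mPo t); split; first by apply: msize_comp_affine => i; rewrite tnth_mktuple msize_affine.
move=> z; rewrite comp_mpoly_meval; apply: meval_eq => i.
rewrite tnth_mktuple mevalD mevalC raddf_sum; congr (_ + _).
by apply: eq_bigr => j _; rewrite /= mevalZ mevalXU.
Qed.

Lemma meval_bounded n d (p : {mpoly F[n]}) z : (msize p <= d)%N ->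
  p.@[z] = \sum_(m : 'X_{1..n < d}) p@_m * ('X_[m] : {mpoly F[n]}).@[z].
Proof.
move=> pd; rewrite {1}(mpolywE pd) raddf_sum.
by apply: eq_bigr => m _; rewrite /= mevalZ.
Qed.

End PolynomialSubstitution.

(** * Regular functions on a linear algebraic group *)

(* The coordinates of the closed embedding g |-> (g, 1 / det g) of GL_n in
   affine space. *)
Definition glcoord (R : realType) (n : nat) (g : 'M[R[i]]_n) : 'I_(n * n).+1 -> R[i] :=
  fun k => if unlift ord_max k is Some j then mxcoord g j 0 else (\det g)^-1.

(** Regular functions on the group and functions on the orbit, pulled back to the group, are both of
    this form, for different coordinates [z], and share the closure properties below. *)
Definition polyfun (F : fieldType) (T : Type) (D : set T) k (z : T -> 'I_k -> F)
    (a : T -> F) : Prop :=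
  exists P : {mpoly F[k]}, forall s, D s -> a s = P.@[z s].

Section Polyfun.
Variables (F : fieldType) (T : Type) (D : set T) (k : nat) (z : T -> 'I_k -> F).
Implicit Types (a b : T -> F).
Local Notation poly := (polyfun D z).

Lemma polyfun_ext a b : (forall s, D s -> a s = b s) -> poly a -> poly b.
Proof. by move=> ab [P aP]; exists P => s Ds; rewrite -ab // aP. Qed.

Lemma polyfun_comp l (f : {mpoly F[l]}) (x : T -> 'I_l -> F) :
  (forall i, poly (fun s => x s i)) -> poly (fun s => f.@[x s]).
Proof.
move=> /choice[P xP]; exists (f \mPo [tuple P i | i < l]) => s Ds.
by rewrite comp_mpoly_meval; apply: meval_eq => i; rewrite tnth_mktuple xP.
Qed.

Lemma polyfun_coord i : poly (fun s => z s i).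
Proof. by exists 'X_i => s _; rewrite mevalXU. Qed.

Lemma polyfun_const c : poly (fun=> c).
Proof. by exists c%:MP => s _; rewrite mevalC. Qed.

Lemma polyfunD a b : poly a -> poly b -> poly (fun s => a s + b s).
Proof. by move=> [P aP] [Q bQ]; exists (P + Q) => s Ds; rewrite mevalD aP ?bQ. Qed.

Lemma polyfunM a b : poly a -> poly b -> poly (fun s => a s * b s).
Proof. by move=> [P aP] [Q bQ]; exists (P * Q) => s Ds; rewrite mevalM aP ?bQ. Qed.

Lemma polyfunZ c a : poly a -> poly (fun s => c * a s).
Proof. exact/polyfunM/polyfun_const. Qed.

Lemma polyfunB a b : poly a -> poly b -> poly (fun s => a s - b s).
Proof. by move=> [P aP] [Q bQ]; exists (P - Q) => s Ds; rewrite mevalB aP ?bQ. Qed.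

Lemma polyfun_sum (I : Type) (r : seq I) (a : I -> T -> F) :
  (forall i, poly (a i)) -> poly (fun s => \sum_(i <- r) a i s).
Proof.
move=> /choice[P aP]; exists (\sum_(i <- r) P i) => s Ds.
by rewrite raddf_sum /=; apply: eq_bigr => i _; rewrite aP.
Qed.

Lemma polyfun_prod (I : Type) (r : seq I) (a : I -> T -> F) :
  (forall i, poly (a i)) -> poly (fun s => \prod_(i <- r) a i s).
Proof.
move=> /choice[P aP]; exists (\prod_(i <- r) P i) => s Ds.
by rewrite rmorph_prod /=; apply: eq_bigr => i _; rewrite aP.
Qed.

Lemma polyfun_mulmx p q r (x : T -> 'M[F]_(p, q)) (y : T -> 'M[F]_(q, r)) :
  (forall i j, poly (fun s => x s i j)) -> (forall i j, poly (fun s => y s i j)) ->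
  forall i j, poly (fun s => (x s *m y s) i j).
Proof.
move=> xr yr i j; apply: (@polyfun_ext (fun s => \sum_l x s i l * y s l j)).
  by move=> s _; rewrite mxE.
by apply: polyfun_sum => l; apply: polyfunM.
Qed.

Lemma polyfun_det p (x : T -> 'M[F]_p) :
  (forall i j, poly (fun s => x s i j)) -> poly (fun s => \det (x s)).
Proof.
move=> xr; rewrite /determinant; apply: polyfun_sum => g.
by apply: polyfunZ; apply: polyfun_prod.
Qed.

Lemma polyfun_adj p (x : T -> 'M[F]_p) i j :
  (forall i j, poly (fun s => x s i j)) -> poly (fun s => (\adj (x s)) i j).
Proof.
move=> xr; apply: (@polyfun_ext
  (fun s => (-1) ^+ (j + i) * \det (row' j (col' i (x s))))).
  by move=> s _; rewrite mxE.
apply: polyfunZ; apply: polyfun_det => i' j'.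
by apply: polyfun_ext (xr (lift j i') (lift i j')) => s _; rewrite !mxE.
Qed.

End Polyfun.

Notation regular G := (polyfun G (@glcoord _ _)).

Lemma invmx_mul (F : fieldType) n (A B : 'M[F]_n) : A \in unitmx -> B \in unitmx ->
  invmx (A *m B) = invmx B *m invmx A.
Proof.
move=> Au Bu; have ABu : A *m B \in unitmx by rewrite unitmx_mul Au.
by apply: (can_inj (mulmxK ABu)); rewrite mulVmx // -mulmxA mulKmx ?mulVmx.
Qed.

Section Regular.
Variables (R : realType) (n : nat) (G : set 'M[R[i]]_n).
Hypothesis G_group : algebraic_group G.
Local Notation C := R[i].
Implicit Types (a b : 'M[C]_n -> C).

Lemma group_unitmx g : G g -> g \in unitmx.
Proof. by have [S ->] := algebraic_group_closed G_group => -[]. Qed.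

Lemma group_det g : G g -> \det g != 0.
Proof. by move/group_unitmx; rewrite unitmxE unitfE. Qed.

Lemma regular_entry i j : regular G (fun g => g i j).
Proof.
exists 'X_(lift ord_max (mxvec_index i j)) => g _.
by rewrite mevalXU /glcoord liftK !mxE mxvecE.
Qed.

Lemma regular_detV : regular G (fun g => (\det g)^-1).
Proof. by exists 'X_ord_max => g _; rewrite mevalXU /glcoord unlift_none. Qed.

Lemma regular_inv_entry i j : regular G (fun g => (invmx g) i j).
Proof.
apply: (@polyfun_ext _ _ _ _ _ (fun g => (\det g)^-1 * (\adj g) i j)).
  by move=> g Gg; rewrite /invmx group_unitmx // [RHS]mxE.
by apply: (polyfunM regular_detV); apply: polyfun_adj => ? ?; apply: regular_entry.
Qed.

Lemma regular_inv a : regular G a -> regular G (fun g => a (invmx g)).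
Proof.
move=> [P aP]; apply: (@polyfun_ext _ _ _ _ _ (fun g => P.@[glcoord (invmx g)])).
  by move=> g Gg; rewrite aP //; apply: algebraic_groupV.
apply: polyfun_comp => k; rewrite /glcoord.
case: unliftP => [j _|_].
  case/mxvec_indexP: j => i j.
  by apply: polyfun_ext (regular_inv_entry i j) => g _; rewrite !mxE mxvecE.
apply: (@polyfun_ext _ _ _ _ _ (fun g => \det g)); last by apply: polyfun_det => ? ?; apply: regular_entry.
by move=> g _; rewrite det_inv invrK.
Qed.

Lemma regular_fun_regular a : regular_fun G a -> regular G a.
Proof.
move=> [p [k aP]]; apply: (@polyfun_ext _ _ _ _ _ (fun g => peval p (mxcoord g) * ((\det g)^-1) ^+ k)).
  by move=> g Gg; rewrite aP // exprVn.
apply: polyfunM.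
  apply: polyfun_comp => l; case/mxvec_indexP: l => i j.
  by apply: polyfun_ext (regular_entry i j) => g _; rewrite !mxE mxvecE.
have [P PP] := regular_detV; exists (P ^+ k) => g Gg.
by rewrite rmorphXn /= -PP.
Qed.

Lemma regular_regular_fun a : regular G a -> regular_fun G a.
Proof.
have [p0 det0] : exists p : {mpoly C[n * n]}, forall g, \det g = peval p (mxcoord g).
  exists (\det (\matrix_(i < n, j < n) 'X_(mxvec_index i j))) => g.
  rewrite /peval -det_map_mx; congr (\det _); apply/matrixP => i j.
  by rewrite !mxE /= mevalXU !mxE mxvecE.
have rconst c : regular_fun G (fun=> c).
  by exists c%:MP, 0%N => g _; rewrite /peval mevalC expr0 divr1.
have rD a1 a2 : regular_fun G a1 -> regular_fun G a2 -> regular_fun G (fun g => a1 g + a2 g).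
  move=> [p1 [k1 e1]] [p2 [k2 e2]].
  exists (p1 * p0 ^+ k2 + p2 * p0 ^+ k1), (k1 + k2)%N => g Gg.
  rewrite e1 // e2 // /peval mevalD !mevalM !rmorphXn /= -!/(peval _ _) -!det0.
  have d0 := group_det Gg.
  have d1 : \det g ^+ k1 != 0 by rewrite expf_neq0.
  have d2 : \det g ^+ k2 != 0 by rewrite expf_neq0.
  by rewrite exprD; field; rewrite d1 d2.
have rM a1 a2 : regular_fun G a1 -> regular_fun G a2 -> regular_fun G (fun g => a1 g * a2 g).
  move=> [p1 [k1 e1]] [p2 [k2 e2]]; exists (p1 * p2), (k1 + k2)%N => g Gg.
  by rewrite e1 // e2 // /peval mevalM exprD invfM; ring.
have rext a1 a2 : (forall g, a1 g = a2 g) -> regular_fun G a1 -> regular_fun G a2.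
  by move=> /funext ->.
have rX k e : regular_fun G (fun g => glcoord g k ^+ e).
  elim: e => [|e IH]; first by apply: rext (rconst 1) => g; rewrite expr0.
  apply: (rext (fun g => glcoord g k * glcoord g k ^+ e)).
    by move=> g; rewrite exprS.
  apply: rM => //; rewrite /glcoord; case: unliftP => [j _|_].
    by exists 'X_j, 0%N => g _; rewrite /peval mevalXU expr0 divr1.
  by exists 1, 1%N => g _; rewrite /peval meval1 expr1 div1r.
move=> [P aP].
have [p [l H]] : regular_fun G (fun g => P.@[glcoord g]).
  elim/mpolyind: P {aP} => [|c m P _ _ IH].
    by apply: rext (rconst 0) => g; rewrite meval0.
  apply: (rext (fun g => c * 'X_[m].@[glcoord g] + P.@[glcoord g])).
    by move=> g; rewrite mevalD mevalZ.
  apply: (rD) => //; apply: (rM) => //.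
  apply: (rext (fun g => \prod_k glcoord g k ^+ m k)).
    by move=> g; rewrite mevalX.
  elim: (index_enum _) => [|k r IHr].
    by apply: rext (rconst 1) => g; rewrite big_nil.
  by apply: rext (rM _ _ (rX k (m k)) IHr) => g; rewrite big_cons.
by exists p, l => g Gg; rewrite aP // H.
Qed.

(** Left translation acts linearly on the coordinates, 1 / det included, and therefore does not
    raise degrees. *)
Lemma glcoord_mull (h : 'M[C]_n) : exists c : 'I_(n * n).+1 -> 'I_(n * n).+1 -> C,
  forall g k, glcoord (h *m g) k = \sum_l c k l * glcoord g l.
Proof.
pose c (k l : 'I_(n * n).+1) := match unlift ord_max k, unlift ord_max l with
  | Some i, Some j => lin_mx (mulmx h) j i
  | None, None => (\det h)^-1
  | _, _ => 0 end.
exists c => g k; rewrite (bigD1_ord ord_max) //=.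
rewrite {2}/glcoord unlift_none {1}/c unlift_none /glcoord.
under eq_bigr => l _ do rewrite liftK.
case: unliftP => [i ->|->].
  rewrite mul0r add0r /mxcoord mxE -mul_vec_lin mxE.
  by apply: eq_bigr => l _; rewrite /c !liftK !mxE mulrC.
rewrite det_mulmx invfM big1 ?addr0 // => l _.
by rewrite /c unlift_none liftK mul0r.
Qed.

End Regular.

(** * Lifting invariants *)

Section Peval.
Variables (R : realType).
Local Notation C := R[i].

Lemma peval_mulmx m k (p : {mpoly C[m]}) (M : 'M[C]_(m, k)) :
  exists q : {mpoly C[k]}, (msize q <= msize p)%N /\ forall z, peval q z = peval p (M *m z).
Proof.
have [q [qp qE]] := affine_substitution (fun=> 0) (fun i j => M i j) p.
exists q; split=> // z; rewrite /peval qE; apply: meval_eq => i.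
by rewrite add0r mxE.
Qed.

Lemma peval_inj m (p q : {mpoly C[m]}) : (forall z, peval p z = peval q z) -> p = q.
Proof.
move=> pq; apply: meval_inj => a.
have := pq (\col_i a i); rewrite /peval.
by rewrite !(@meval_eq _ _ (fun i => (\col_i a i) i 0) a) // => i; rewrite mxE.
Qed.

End Peval.

Section InvariantLift.
Variables (R : realType) (n : nat) (G : set 'M[R[i]]_n).
Hypothesis G_reductive : reductive G.
Variables (m : nat) (rho : 'M[R[i]]_n -> 'M[R[i]]_m).
Hypothesis rho_rational : rational_rep G rho.
Local Notation C := R[i].

(* A substitute for the Reynolds operator: a tuple of polynomials which is
   invariant modulo a G-stable subspace K is congruent mod K to a tuple of
   invariants. *)
Lemma invariant_lift r (K : set ('I_r * 'cV[C]_m -> C)) (x : 'I_r -> {mpoly C[m]}) :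
  is_subspace K ->
  (forall g u, G g -> K u -> K (fun s => u (s.1, rho g *m s.2))) ->
  (forall g, G g -> K (fun s => peval (x s.1) (rho g *m s.2) - peval (x s.1) s.2)) ->
  exists x', (forall i, is_invariant G rho (x' i)) /\
    K (fun s => peval (x s.1) s.2 - peval (x' s.1) s.2).
Proof.
move=> subK stabK Kx; have [G_group G_cr] := G_reductive.
have G1 := algebraic_group1 G_group.
have GM := algebraic_groupM G_group; have GV := algebraic_groupV G_group.
pose d := \max_(i < r) msize (x i).
(* Tuples of polynomials of bounded degree, seen as functions, form a finite-dimensional space that
   is stable under the group. *)
pose X : set ('I_r * 'cV[C]_m -> C) := [set u | exists h : 'I_r -> {mpoly C[m]},
  (forall i, msize (h i) <= d)%N /\ forall s, u s = peval (h s.1) s.2].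
have subX : is_subspace X.
  split=> [|a u w [h [hd uh]] [k [kd wk]]].
    by exists (fun=> 0); split=> [i|s]; rewrite ?msize0 // /peval meval0.
  exists (fun i => a *: h i + k i); split=> [i|s].
    apply: leq_trans (msizeD_le _ _) _; rewrite geq_max kd andbT.
    exact: leq_trans (msizeZ_le _ _) _.
  by rewrite uh wk /peval mevalD mevalZ.
have XG g u : X u -> X (fun s => u (s.1, rho g *m s.2)).
  move=> [h [hd uh]].
  have [k kP] := choice (fun i => peval_mulmx (h i) (rho g)).
  exists k; split=> [i|s]; first by have [/leq_trans-> //] := kP i.
  by rewrite uh; have [_ ->] := kP s.1.
have Xx : X (fun s => peval (x s.1) s.2).
  by exists x; split=> // i; apply: leq_bigmax.
have [|p [y [t [Xy _ yt XE]]]] := @interpolation_basis _ _ setT X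
    ('I_r * 'X_{1..m < d})%type
    (fun j s => (j.1 == s.1)%:R * ('X_[j.2] : {mpoly C[m]}).@[fun i => s.2 i 0]) subX.
  move=> u [h [hd uh]]; exists (fun j : 'I_r * 'X_{1..m < d} => (h j.1)@_(bmnm j.2)) => s _.
  rewrite uh /peval (meval_bounded _ (hd s.1)).
  rewrite -(pair_bigA _ (fun i (l : 'X_{1..m < d}) => (h i)@_l *
    ((i == s.1)%:R * ('X_[l] : {mpoly C[m]}).@[fun i => s.2 i 0]))) /=.
  rewrite [RHS](bigD1 s.1) //= [X in _ + X]big1 ?addr0 => [|i ni].
    by apply: eq_bigr => l _; rewrite eqxx mul1r.
  by apply: big1 => l _; rewrite (negbTE ni) mul0r mulr0.
pose T g := \matrix_(k, l) y k ((t l).1, rho g *m (t l).2).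
have yT g k s : y k (s.1, rho g *m s.2) = \sum_l T g k l * y l s.
  rewrite (XE _ (XG g _ (Xy k)) s I).
  by apply: eq_bigr => l _; rewrite mxE.
have T1 : T 1%:M = 1%:M.
  apply/matrixP => k l; rewrite !mxE (rational_rep1 rho_rational) mul1mx.
  by rewrite -surjective_pairing yt.
have TM g h : G g -> G h -> T (g *m h) = T g *m T h.
  move=> Gg Gh; apply/matrixP => k l; rewrite !mxE.
  rewrite (rational_repM rho_rational) // -mulmxA.
  rewrite (yT g k ((t l).1, rho h *m (t l).2)).
  by apply: eq_bigr => j _; rewrite !mxE.
(* [T] describes precomposition on the basis functions; on coordinate vectors the group acts on the
   left through the transpose at the inverse. Complete reducibility is applied to this
   representation. *)
pose rho' g := (T (invmx g))^T.
have rho'_rat : rational_rep G rho'.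
  split=> [|g h Gg Gh|k l].
  - by rewrite /rho' invmx1 T1 trmx1.
  - have gU := group_unitmx G_group Gg; have hU := group_unitmx G_group Gh.
    by rewrite /rho' -trmx_mul -TM ?invmx_mul //; apply: GV.
  - apply: (regular_regular_fun G_group); rewrite /rho'.
    have [h [_ yh]] := Xy l.
    apply: (@polyfun_ext _ _ _ _ _ (fun g => peval (h (t k).1) (rho (invmx g) *m (t k).2))).
      by move=> g _; rewrite !mxE yh.
    apply: (regular_inv G_group (a := fun g => peval (h (t k).1) (rho g *m (t k).2))).
    apply: polyfun_comp => i.
    apply: (@polyfun_ext _ _ _ _ _ (fun g => \sum_j rho g i j * (t k).2 j 0)).
      by move=> g _; rewrite mxE.
    apply: polyfun_sum => j; apply: polyfunM (polyfun_const _ _ _).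
    exact/regular_fun_regular/(rational_rep_regular rho_rational).
pose Y (u : 'cV[C]_p) s := \sum_k u k 0 * y k s.
have XY u : X (Y u) by apply: subspace_sum.
have Yrho g u s : G g -> Y (rho' g *m u) s = Y u (s.1, rho (invmx g) *m s.2).
  move=> Gg; rewrite /Y.
  transitivity (\sum_l \sum_k T (invmx g) k l * u k 0 * y l s).
    by apply: eq_bigr => l _; rewrite !mxE mulr_suml; apply: eq_bigr => k _; rewrite !mxE.
  rewrite exchange_big; apply: eq_bigr => k _; rewrite yT mulr_sumr.
  by apply: eq_bigr => l _; rewrite mulrCA mulrA.
have YL a u w s : Y (a *: u + w) s = a * Y u s + Y w s.
  rewrite /Y mulr_sumr -big_split /=; apply: eq_bigr => k _.
  by rewrite !mxE mulrDl mulrA.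
have [|a u w Ku Kw|U UP] := @vspace_of_set C 'cV[C]_p [set u | K (Y u)].
- apply: subspace_ext (subspace0 subK) => s.
  by rewrite /Y big1 // => k _; rewrite mxE mul0r.
- by apply: subspace_ext (subspaceP subK a Ku Kw) => s; rewrite YL.
have [|U' [stabU' UU' capU]] := G_cr p rho' rho'_rat U.
  move=> g u Gg /UP /= Ku; apply/UP.
  by apply: subspace_ext (stabK _ _ (GV _ Gg) Ku) => s; rewrite Yrho.
pose u0 : 'cV[C]_p := \col_k peval (x (t k).1) (t k).2.
have Yu0 s : Y u0 s = peval (x s.1) s.2.
  by rewrite (XE _ Xx s I); apply: eq_bigr => k _; rewrite mxE.
(* Write x = a + b with a in [K] and b in a stable complement. Then g b - b lies in the complement,
   and also in [K] because g x - x and g a - a do; hence b is invariant. *)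
have : u0 \in (U + U')%VS by rewrite UU' memvf.
case/memv_addP=> a aU [b bU' u0E].
have binv g : G g -> rho' g *m b = b.
  move=> Gg; apply/eqP; rewrite -subr_eq0 -memv0 -capU memv_cap.
  apply/andP; split; last by apply: memvB => //; exact: stabU'.
  have -> : rho' g *m b - b = (rho' g *m u0 - u0) - (rho' g *m a - a).
    by rewrite u0E mulmxDr opprD addrACA [_ + (rho' g *m b - b)]addrC addrK.
  apply: memvB; last first.
    apply: memvB => //; apply/UP; move/UP: aU => /= Ka.
    by apply: subspace_ext (stabK _ _ (GV _ Gg) Ka) => s; rewrite Yrho.
  apply/UP => /=; apply: subspace_ext (Kx _ (GV _ Gg)) => s.
  have -> : rho' g *m u0 - u0 = (-1) *: u0 + rho' g *m u0 by rewrite scaleN1r addrC.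
  by rewrite YL mulN1r Yrho // !Yu0 addrC.
have [x' [_ x'E]] := XY b.
exists x'; split=> [i g Gg z|].
  have := Yrho (invmx g) b (i, z) (GV _ Gg); rewrite (binv _ (GV _ Gg)) invmxK.
  by rewrite !x'E.
move/UP: aU; apply: subspace_ext => s; rewrite -x'E -Yu0 u0E.
have -> : a + b = 1 *: a + b by rewrite scale1r.
by rewrite YL mul1r addrK.
Qed.

End InvariantLift.

(** * Functions on a closed orbit *)

Section BoundedDegree.
Variables (R : realType) (n : nat) (G : set 'M[R[i]]_n).
Hypothesis G_group : algebraic_group G.
Local Notation C := R[i].
Implicit Types (a b : 'M[C]_n -> C).

(** Since [msize] is the degree plus one, d bounds degrees strictly. The pieces of this filtration
    are finite-dimensional and stable under left translation, which gives bounds uniform in the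
    group element. *)
Definition regular_le d a := exists P : {mpoly C[(n * n).+1]},
  (msize P <= d)%N /\ forall g, G g -> a g = P.@[glcoord g].

Lemma regular_le_subspace d : is_subspace (regular_le d).
Proof.
split=> [|c u w [P [Pd uP]] [Q [Qd wQ]]].
  by exists 0; split=> [|g _]; rewrite ?msize0 ?meval0.
exists (c *: P + Q); split=> [|g Gg]; last by rewrite mevalD mevalZ uP ?wQ.
apply: leq_trans (msizeD_le _ _) _; rewrite geq_max Qd andbT.
exact: leq_trans (msizeZ_le _ _) _.
Qed.

Lemma regular_le_regular d a : regular_le d a -> regular G a.
Proof. by move=> [P [_ aP]]; exists P. Qed.

Lemma regular_regular_le a : regular G a -> exists d, regular_le d a.
Proof. by move=> [P aP]; exists (msize P), P. Qed.

Lemma regular_leW d e a : (d <= e)%N -> regular_le d a -> regular_le e a.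
Proof. by move=> de [P [Pd aP]]; exists P; split=> //; apply: leq_trans de. Qed.

Lemma regular_leM d e a b : regular_le d a -> regular_le e b ->
  regular_le (d + e) (fun g => a g * b g).
Proof.
move=> [P [Pd aP]] [Q [Qe bQ]]; exists (P * Q); split=> [|g Gg].
  apply: leq_trans (msizeM_pred_le _ _) _.
  by apply: leq_trans (leq_pred _) _; apply: leq_add.
by rewrite mevalM aP ?bQ.
Qed.

Lemma regular_leX d e a : regular_le d.+1 a -> regular_le (d * e).+1 (fun g => a g ^+ e).
Proof.
move=> [P [Pd aP]]; exists (P ^+ e); split=> [|g Gg]; first exact: msize_exp_le.
by rewrite rmorphXn /= aP.
Qed.

Lemma regular_le_mull d a h : G h -> regular_le d a -> regular_le d (fun g => a (h *m g)).
Proof.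
move=> Gh [P [Pd aP]]; have [c hc] := glcoord_mull h.
have [Q [QP QE]] := affine_substitution (fun=> 0) c P.
exists Q; split=> [|g Gg]; first exact: leq_trans Pd.
rewrite aP ?QE; last exact: algebraic_groupM.
by apply: meval_eq => k; rewrite hc add0r.
Qed.

Lemma regular_le_basis d (X : set ('M[C]_n -> C)) :
  is_subspace X -> X `<=` regular_le d ->
  exists r (y : 'I_r -> 'M[C]_n -> C) (t : 'I_r -> 'M[C]_n),
    [/\ forall k, X (y k), forall k, G (t k),
        forall k l, y k (t l) = (k == l)%:R &
        forall u, X u -> forall g, G g -> u g = \sum_k u (t k) * y k g].
Proof.
move=> subX Xd; apply: (@interpolation_basis _ _ G X 'X_{1..(n * n).+1 < d}
    (fun m g => ('X_[m] : {mpoly C[(n * n).+1]}).@[glcoord g])) => // u /Xd[P [Pd uP]].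
by exists (fun m : 'X_{1..(n * n).+1 < d} => P@_(bmnm m)) => g Gg; rewrite uP // (meval_bounded _ Pd).
Qed.

(** The image of [G] in affine space is Zariski closed: the equation det * X_last = 1 forces an
    invertible matrix, and the equations of [G] in GL_n do the rest. *)
Lemma glcoord_surj (a : 'I_(n * n).+1 -> C) :
  (forall P : {mpoly C[(n * n).+1]}, (forall g, G g -> P.@[glcoord g] = 0) -> P.@[a] = 0) ->
  exists g, G g /\ glcoord g =1 a.
Proof.
move=> aP; pose g : 'M[C]_n := vec_mx (\row_j a (lift ord_max j)).
have coordE (h : 'M[C]_n) j : glcoord h (lift ord_max j) = mxcoord h j 0.
  by rewrite /glcoord liftK.
have ga j : mxcoord g j 0 = a (lift ord_max j).
  by rewrite /mxcoord mxE vec_mxK mxE.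
pose D : {mpoly C[(n * n).+1]} :=
  \det (\matrix_(i < n, j < n) 'X_(lift ord_max (mxvec_index i j))).
have detE (b : 'I_(n * n).+1 -> C) (h : 'M[C]_n) :
    (forall j, mxcoord h j 0 = b (lift ord_max j)) -> D.@[b] = \det h.
  move=> hb; rewrite -det_map_mx; congr (\det _); apply/matrixP => i j.
  by rewrite !mxE /= mevalXU -hb /mxcoord mxE mxvecE.
have : (D * 'X_ord_max - 1).@[a] = 0.
  apply: aP => h Gh; rewrite mevalB mevalM meval1 mevalXU (detE _ h) //.
  by rewrite /glcoord unlift_none mulfV ?subrr ?(group_det G_group).
rewrite mevalB mevalM meval1 mevalXU (detE _ g) // => /eqP.
rewrite subr_eq0 => /eqP deta.
have d0 : \det g != 0.
  by apply/eqP => d0; move/eqP: deta; rewrite d0 mul0r eq_sym oner_eq0.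
have ga' : glcoord g =1 a.
  move=> k; rewrite /glcoord; case: unliftP => [j ->|->]; first exact: ga.
  by rewrite -[a _]mul1r -(mulVf d0) -mulrA deta mulr1.
exists g; split=> //; have [S GS] := algebraic_group_closed G_group.
rewrite GS; split; first by rewrite unitmxE unitfE.
move=> f Sf.
have compE (b : 'I_(n * n).+1 -> C) : (f \mPo [tuple 'X_(lift ord_max j) | j < n * n]).@[b] =
    f.@[fun j => b (lift ord_max j)].
  by rewrite comp_mpoly_meval; apply: meval_eq => j; rewrite tnth_mktuple mevalXU.
rewrite /peval -(@meval_eq _ _ (fun j => a (lift ord_max j))) // -compE.
apply: aP => h; rewrite GS => -[_ /(_ f Sf)].
by rewrite compE /peval => <-; apply: meval_eq => j; rewrite coordE.
Qed.

End BoundedDegree.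

Lemma eventually_uniform_expr (A : comNzRingType) (I : set A) (s : seq A) :
  is_ideal I -> (forall x, x \in s -> exists p, I (x ^+ p)) ->
  exists p, forall x, x \in s -> I (x ^+ p).
Proof.
move=> idI; elim: s => [|x s IH] sI; first by exists 0%N.
have [|p pP] := IH; first by move=> y ys; apply: sI; rewrite inE ys orbT.
have [q qP] := sI x (mem_head _ _); exists (p + q)%N => y.
rewrite inE exprD => /predU1P[->|/pP ?]; first exact: idealMl.
exact: ideal_mulr.
Qed.

(** * The scheme-theoretic fibre of the orbit map *)

Definition orbit_coord (R : realType) (n m : nat) (rho : 'M[R[i]]_n -> 'M[R[i]]_m)
    (v : 'cV[R[i]]_m) (g : 'M[R[i]]_n) : 'I_m -> R[i] := fun i => (rho g *m v) i 0.

Section Orbit.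
Variables (R : realType) (n : nat) (G : set 'M[R[i]]_n).
Hypothesis G_group : algebraic_group G.
Variables (m : nat) (rho : 'M[R[i]]_n -> 'M[R[i]]_m).
Hypothesis rho_rational : rational_rep G rho.
Variable v : 'cV[R[i]]_m.
Local Notation C := R[i].
Local Notation H := (rep_stabilizer G rho v).
Implicit Types (a b f : 'M[C]_n -> C).

Local Notation y := (orbit_coord rho v).
Local Notation orbitfun := (polyfun G y).

Lemma orbit_coordM g u i : G g -> G u -> y (g *m u) i = \sum_j rho g i j * y u j.
Proof. by move=> Gg Gu; rewrite /orbit_coord (rational_repM rho_rational) // -mulmxA mxE. Qed.

Lemma orbit_coord1 i : y 1%:M i = v i 0.
Proof. by rewrite /orbit_coord (rational_rep1 rho_rational) mul1mx. Qed.

Lemma regular_rho i j : regular G (fun g => rho g i j).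
Proof. exact/regular_fun_regular/(rational_rep_regular rho_rational). Qed.

Lemma regular_orbit i : regular G (fun g => y g i).
Proof.
apply: polyfun_mulmx => [k l|k l]; first exact: regular_rho.
exact: polyfun_const.
Qed.

(* The ideal of the fibre over v of the orbit map, a possibly non-reduced
   scheme structure on the stabilizer. *)
Definition fibre_ideal a := exists c : 'I_m -> 'M[C]_n -> C,
  (forall i, regular G (c i)) /\
  forall g, G g -> a g = \sum_i (y g i - v i 0) * c i g.

Lemma fibre_ideal_ext a b : (forall g, G g -> a g = b g) ->
  fibre_ideal a -> fibre_ideal b.
Proof. by move=> ab [c [cr aE]]; exists c; split=> // g Gg; rewrite -ab // aE. Qed.

Lemma fibre_ideal_subspace : is_subspace fibre_ideal.
Proof.
split=> [|k a b [c [cr aE]] [d [dr bE]]].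
  exists (fun i g => 0); split=> [i|g Gg]; first exact: polyfun_const.
  by rewrite big1 // => i _; rewrite mulr0.
exists (fun i g => k * c i g + d i g); split=> [i|g Gg].
  by apply: polyfunD => //; apply: polyfunZ.
rewrite aE // bE // mulr_sumr -big_split /=; apply: eq_bigr => i _.
by rewrite mulrDr mulrCA.
Qed.

Lemma fibre_idealMl a b : regular G b -> fibre_ideal a -> fibre_ideal (fun g => b g * a g).
Proof.
move=> br [c [cr aE]]; exists (fun i g => b g * c i g); split=> [i|g Gg].
  exact: polyfunM.
by rewrite aE // mulr_sumr; apply: eq_bigr => i _; rewrite mulrCA.
Qed.

Lemma fibre_ideal_coord i : fibre_ideal (fun g => y g i - v i 0).
Proof.
exists (fun j g => (j == i)%:R); split=> [j|g Gg]; first exact: polyfun_const.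
rewrite (bigD1 i) //= eqxx mulr1 big1 ?addr0 // => j /negbTE ->.
by rewrite mulr0.
Qed.

Lemma fibre_ideal_ideal k (z : 'M[C]_n -> 'I_k -> C) :
  (forall i, regular G (fun g => z g i)) ->
  is_ideal [set P : {mpoly C[k]} | fibre_ideal (fun g => P.@[z g])].
Proof.
move=> zr; split=> [|P Q JP JQ|P Q JQ] /=.
- by apply: fibre_ideal_ext (subspace0 fibre_ideal_subspace) => g _; rewrite meval0.
- apply: fibre_ideal_ext (subspaceD fibre_ideal_subspace JP JQ) => g _.
  by rewrite mevalD.
- have Pr : regular G (fun g => P.@[z g]) by apply: polyfun_comp.
  by apply: fibre_ideal_ext (fibre_idealMl Pr JQ) => g _; rewrite mevalM.
Qed.

Lemma fibre_ideal1 a : fibre_ideal a -> a 1%:M = 0.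
Proof.
move=> [c [_ aE]]; rewrite aE; last exact: algebraic_group1.
by rewrite big1 // => i _; rewrite orbit_coord1 subrr mul0r.
Qed.

(** The zero set of the fibre ideal is the stabilizer, so the Nullstellensatz puts a power of each
    function vanishing there into the ideal; finite generation makes the exponent uniform. *)
Lemma stabilizer_nilpotent : exists s, forall a, regular G a ->
  (forall h, H h -> a h = 0) -> fibre_ideal (fun g => a g ^+ s).
Proof.
pose J := [set P : {mpoly C[(n * n).+1]} | fibre_ideal (fun g => P.@[glcoord g])].
have idJ : is_ideal J by apply: fibre_ideal_ideal => k; apply: polyfun_coord.
have [r [rH Hr]] := hilbert_basis
  [set P : {mpoly C[(n * n).+1]} | forall h, H h -> P.@[glcoord h] = 0].
have [|p pP] := @eventually_uniform_expr _ J r idJ.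
  move=> P /rH /= PH; apply: nullstellensatz => // b bJ.
  have [|g [Gg gb]] := @glcoord_surj _ _ _ G_group b.
    move=> Q QG; apply: bJ.
    by apply: fibre_ideal_ext (subspace0 fibre_ideal_subspace) => g Gg; rewrite QG.
  rewrite -(meval_eq P gb); apply: PH; split=> //.
  apply/matrixP => i j; rewrite ord1 {j}.
  have [Q QE] := regular_orbit i.
  have : (Q - (v i 0)%:MP).@[b] = 0.
    apply: bJ; apply: fibre_ideal_ext (fibre_ideal_coord i) => g' Gg'.
    by rewrite mevalB mevalC QE.
  rewrite -(meval_eq _ gb) mevalB mevalC -QE // => /eqP.
  by rewrite subr_eq0 => /eqP.
have [q qP] := gen_ideal_expr idJ pP.
exists q => a [P aP] aH; have : J (P ^+ q).
  by apply/qP/Hr => h Hh; have [Gh _] := Hh; rewrite -aP // aH.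
by apply: fibre_ideal_ext => g Gg; rewrite rmorphXn /= aP.
Qed.

Definition stab_invariant f := regular G f /\
  forall g h, G g -> H h -> f (g *m h) = f g.

Lemma stab_invariant_mull f g : G g -> stab_invariant f ->
  stab_invariant (fun u => f (g *m u)).
Proof.
move=> Gg [fr fH]; have GM := algebraic_groupM G_group; split=> [|u h Gu Hh].
  have [d fd] := regular_regular_le fr.
  exact/regular_le_regular/(regular_le_mull G_group Gg fd).
by rewrite mulmxA fH //; apply: GM.
Qed.

Lemma orbitfun_mull b g : G g -> orbitfun b -> orbitfun (fun u => b (g *m u)).
Proof.
move=> Gg [q bq]; apply: (@polyfun_ext _ _ _ _ _ (fun u => q.@[y (g *m u)])).
  by move=> u Gu; rewrite bq //; apply: algebraic_groupM.
apply: polyfun_comp => i.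
apply: (@polyfun_ext _ _ _ _ _ (fun u => \sum_j rho g i j * y u j)).
  by move=> u Gu; rewrite orbit_coordM.
by apply: polyfun_sum => j; apply: polyfunZ; apply: polyfun_coord.
Qed.

Lemma orbitfun_fibre b : orbitfun b -> fibre_ideal (fun g => b g - b 1%:M).
Proof.
move=> [q bq]; have G1 := algebraic_group1 G_group.
have := @mpoly_sub_meval R m [set q | fibre_ideal (fun g => q.@[y g])] (fun i => v i 0).
move=> /(_ (fibre_ideal_ideal regular_orbit)) => /(_ _ q) /=.
move=> H1; apply: fibre_ideal_ext (H1 _) => [g Gg|i].
  rewrite mevalB mevalC bq // bq //; congr (_ - _); apply: meval_eq => i.
  by rewrite orbit_coord1.
by apply: fibre_ideal_ext (fibre_ideal_coord i) => g Gg; rewrite mevalB mevalXU mevalC.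
Qed.

Section Power.
Variable N : nat.
Hypothesis nilN : forall f, stab_invariant f ->
  fibre_ideal (fun g => (f g - f 1%:M) ^+ N).

(** The point of the statement is that d does not depend on g. The translates (f(g w) - f(g))^N all
    lie in the finite-dimensional space of elements of the fibre ideal of bounded degree, and a
    basis of that space has finitely many coefficient functions. *)
Lemma nilpotent_uniform f : stab_invariant f ->
  exists d, forall g, G g -> exists e : 'I_m -> 'M[C]_n -> C,
    (forall i, regular_le G d (e i)) /\
    forall u, G u -> (f u - f g) ^+ N = \sum_i (y u i - y g i) * e i u.
Proof.
move=> fI; have [fr fH] := fI.
have G1 := algebraic_group1 G_group.
have GM := algebraic_groupM G_group; have GV := algebraic_groupV G_group.
have [d0 fd0] := regular_regular_le fr.
have {d0 fd0} [d fd] : exists d, regular_le G d.+1 f.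
  by exists d0; apply: regular_leW fd0.
pose X a := regular_le G (d * N).+1 a /\ fibre_ideal a.
have subX : is_subspace X.
  have s1 := regular_le_subspace G (d * N).+1; have s2 := fibre_ideal_subspace.
  split=> [|c a b [a1 a2] [b1 b2]]; first by split; [apply: subspace0 s1 | apply: subspace0 s2].
  by split; [apply: subspaceP s1 _ _ _ _ _ | apply: subspaceP s2 _ _ _ _ _].
have [|r [z [t [Xz Gt _ XE]]]] := @regular_le_basis _ _ G (d * N).+1 X subX.
  by move=> a [].
have [c cP] := choice (fun k => (Xz k).2).
have [D0 D0P] := choice (fun ki : 'I_r * 'I_m => regular_regular_le ((cP ki.1).1 ki.2)).
pose D := \max_ki D0 ki.
have cD k i : regular_le G D (c k i).
  by apply: regular_leW (D0P (k, i)); apply: leq_bigmax.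
exists D => g Gg.
pose F w := (f (g *m w) - f g) ^+ N.
have XF : X F.
  split.
    apply: regular_leX; apply: subspaceB; first exact: regular_le_subspace.
      exact: regular_le_mull.
    exists (f g)%:MP; split=> [|u _]; last by rewrite mevalC.
    by rewrite msizeC; apply: leq_trans (leq_b1 _) _.
  have := nilN (stab_invariant_mull Gg fI); apply: fibre_ideal_ext => w Gw.
  by rewrite mulmx1.
(* With w = g^-1 u one has y(w) - v = rho(g^-1) (y(u) - y(g)), which turns the coefficients at w
   into coefficients of the y_j(u) - y_j(g). *)
exists (fun j u => \sum_i rho (invmx g) i j * \sum_k F (t k) * c k i (invmx g *m u)).
split=> [j|u Gu].
  apply: subspace_sum; first exact: regular_le_subspace.
  move=> i; apply: subspace_sum; first exact: regular_le_subspace.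
  by move=> k; apply: regular_le_mull => //; apply: GV.
have Gw := GM _ _ (GV _ Gg) Gu.
have gw : g *m (invmx g *m u) = u by rewrite mulKVmx // (group_unitmx G_group).
have -> : (f u - f g) ^+ N = F (invmx g *m u) by rewrite /F gw.
rewrite (XE _ XF _ Gw).
transitivity (\sum_i (y (invmx g *m u) i - v i 0) * \sum_k F (t k) * c k i (invmx g *m u)).
  under eq_bigr => k _ do rewrite (cP k).2 // mulr_sumr.
  rewrite exchange_big; apply: eq_bigr => i _; rewrite mulr_sumr.
  by apply: eq_bigr => k _; rewrite mulrCA.
have vE i : v i 0 = \sum_j rho (invmx g) i j * y g j.
  by rewrite -(orbit_coordM _ (GV _ Gg) Gg) mulVmx ?orbit_coord1 //; apply: group_unitmx G_group _ _.
under eq_bigr => i _.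
  rewrite vE (orbit_coordM _ (GV _ Gg) Gu) -sumrB mulr_suml.
  under eq_bigr => j _ do rewrite -mulrBr -mulrA mulrCA.
  over.
by rewrite exchange_big; apply: eq_bigr => j _; rewrite mulr_sumr.
Qed.

End Power.
End Orbit.

(** * Linear forms over the ring of functions on the orbit *)

(** Reversing the order of the rows makes the matrix triangular with s_N along the diagonal. *)
Lemma det_hankel_neq0 (F : fieldType) N (s : nat -> F) :
  s N != 0 -> (forall i, (N < i <= N + N)%N -> s i = 0) ->
  \det (\matrix_(j < N.+1, k < N.+1) s (j + k)%N) != 0.
Proof.
move=> sN s0; set M := \matrix_(j, k) _.
pose P := \matrix_(j < N.+1, k < N.+1) (k == rev_ord j)%:R : 'M[F]_N.+1.
have PME j k : (P *m M) j k = s (N - j + k)%N.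
  rewrite mxE (bigD1 (rev_ord j)) //= big1 ?addr0 => [|l /negbTE lj].
    by rewrite !mxE eqxx mul1r /= subSS.
  by rewrite !mxE lj mul0r.
have : \det (P *m M) != 0.
  rewrite det_trig; last first.
    apply/is_trig_mxP => j k jk; rewrite PME s0 //; have := ltn_ord k; lia.
  apply/prodf_neq0 => j _; rewrite PME subnK //.
  by rewrite -ltnS.
by rewrite det_mulmx mulf_eq0 negb_or => /andP[].
Qed.

Lemma row_space_of_set (F : fieldType) r (P : set 'rV[F]_r) :
  P 0 -> (forall a u w, P u -> P w -> P (a *: u + w)) ->
  exists p (D : 'M[F]_(p, r)), [/\ row_free D, forall i, P (row i D) &
    forall u, P u -> (u <= D)%MS].
Proof.
move=> P0 PL; have [U UP] := vspace_of_set P0 PL.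
pose D := \matrix_(i < \dim U) (vbasis U)`_i.
have Db i : row i D = (vbasis U)`_i by apply/rowP => j; rewrite !mxE.
exists (\dim U), D; split=> [|i|u /UP uU].
- apply: inj_row_free => w; rewrite mulmx_sum_row.
  under eq_bigr => i _ do rewrite Db.
  move=> w0; apply/rowP => i; rewrite mxE.
  by have /freeP := basis_free (vbasisP U); apply.
- by apply/UP; rewrite Db; apply/vbasis_mem/mem_nth; rewrite size_tuple.
- apply/submxP; exists (\row_i coord (vbasis U) i u).
  rewrite mulmx_sum_row {1}(coord_vbasis uU); apply: eq_bigr => i _.
  by rewrite mxE Db.
Qed.

Lemma submx_separate (F : fieldType) p r (D : 'M[F]_(p, r)) (u : 'rV[F]_r) :
  ~~ (u <= D)%MS -> exists w : 'cV[F]_r, D *m w = 0 /\ (u *m w) 0 0 != 0.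
Proof.
rewrite submxE => /rV0Pn[j uj]; exists (col j (cokermx D)).
split; first by rewrite colE mulmxA mulmx_coker mul0mx.
by rewrite colE mulmxA -colE mxE.
Qed.

Section OrbitFunctions.
Variables (R : realType) (n : nat) (G : set 'M[R[i]]_n).
Hypothesis G_group : algebraic_group G.
Variables (m : nat) (rho : 'M[R[i]]_n -> 'M[R[i]]_m).
Hypothesis rho_rational : rational_rep G rho.
Variable v : 'cV[R[i]]_m.
Local Notation C := R[i].
Local Notation H := (rep_stabilizer G rho v).
Local Notation y := (orbit_coord rho v).
Local Notation orbitfun := (polyfun G y).
Local Notation fibre_ideal := (fibre_ideal G rho v).
Local Notation stab_invariant := (stab_invariant G rho v).
Implicit Types (a b f : 'M[C]_n -> C).

Section BoundedFunctional.
Variable d : nat.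
Variables (r : nat) (z : 'I_r -> 'M[C]_n -> C) (t : 'I_r -> 'M[C]_n).
Hypotheses (zd : forall k, regular_le G d (z k)) (Gt : forall k, G (t k))
  (zt : forall k l, z k (t l) = (k == l)%:R)
  (zE : forall u, regular_le G d u -> forall g, G g -> u g = \sum_k u (t k) * z k g).

(** The syzygies of the z_k over the ring of functions on the orbit. A linear form on the module
    spanned by the z_k is a vector that annihilates them. *)
Definition relation (beta : 'M[C]_n -> 'rV[C]_r) :=
  (forall k, orbitfun (fun g => beta g 0 k)) /\
  forall g, G g -> \sum_k beta g 0 k * z k g = 0.

Definition coords a : 'rV[C]_r := \row_k a (t k).

Lemma coordsE a : regular_le G d a -> forall g, G g -> a g = \sum_k coords a 0 k * z k g.
Proof. by move=> ad g Gg; rewrite (zE ad Gg); apply: eq_bigr => k _; rewrite mxE. Qed.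

(** The matrix of left translation by g on the functions of bounded degree. *)
Let T g := \matrix_(k, l) z k (g *m t l).

Let zT g u k : G g -> G u -> z k (g *m u) = \sum_l T g k l * z l u.
Proof.
move=> Gg Gu; rewrite (zE (regular_le_mull G_group Gg (zd k)) Gu).
by apply: eq_bigr => l _; rewrite mxE.
Qed.

Let T_unit g : G g -> T g \in unitmx.
Proof.
move=> Gg; have GV := algebraic_groupV G_group Gg.
have gU := group_unitmx G_group Gg.
suff /mulmx1_unit[] : T g *m T (invmx g) = 1%:M by [].
apply/matrixP => k l; rewrite !mxE -zt.
have GVt := algebraic_groupM G_group GV (Gt l).
rewrite -[t l](mulKVmx gU) zT //.
by apply: eq_bigr => j _; rewrite !mxE.
Qed.

(** This carries the relations at g to relations at 1 by an invertible matrix, and so makes their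
    rank constant. *)
Let relation_translate beta g : G g -> relation beta ->
  relation (fun u => beta (g *m u) *m T g).
Proof.
move=> Gg [bo b0]; split=> [k|u Gu].
  apply: polyfun_mulmx => [i j|i j]; last exact: polyfun_const.
  rewrite (ord1 i).
  exact: (orbitfun_mull G_group rho_rational (b := fun u => beta u 0 j)).
rewrite -[RHS](b0 (g *m u)); last exact: algebraic_groupM.
under [RHS]eq_bigr => k _ do rewrite zT // mulr_sumr.
rewrite exchange_big; apply: eq_bigr => l _; rewrite mxE mulr_suml.
by apply: eq_bigr => k _; rewrite mulrA.
Qed.

(* The relations between the z_k over the ring of functions on the orbit have
   constant rank by homogeneity.  Hence a linear form annihilating them at 1
   extends, after multiplication by a function which does not vanish at 1, to a
   vector of functions on the orbit annihilating all of them. *)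
Lemma functional_extend a : regular_le G d a -> ~ fibre_ideal a ->
  exists mu : 'M[C]_n -> 'cV[C]_r,
    [/\ forall k, orbitfun (fun g => mu g k 0),
        forall beta g, G g -> relation beta -> beta g *m mu g = 0 &
        (coords a *m mu 1%:M) 0 0 != 0].
Proof.
move=> ad na; have G1 := algebraic_group1 G_group.
pose P (w : 'rV[C]_r) := exists beta, relation beta /\ w = beta 1%:M.
have P0 : P 0.
  exists (fun=> 0); split=> //; split=> [k|g _].
    by apply: (@polyfun_ext _ _ _ _ _ (fun=> 0)); [move=> g _; rewrite mxE | exact: polyfun_const].
  by rewrite big1 // => k _; rewrite mxE mul0r.
have PL c u w : P u -> P w -> P (c *: u + w).
  move=> [b [[bo b0] ->]] [b' [[bo' b0'] ->]].
  exists (fun g => c *: b g + b' g); split=> //; split=> [k|g Gg].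
    apply: (@polyfun_ext _ _ _ _ _ (fun g => c * b g 0 k + b' g 0 k)).
      by move=> g _; rewrite !mxE.
    by apply: polyfunD => //; apply: polyfunZ.
  transitivity (c * (\sum_k b g 0 k * z k g) + \sum_k b' g 0 k * z k g).
    rewrite mulr_sumr -big_split; apply: eq_bigr => k _.
    by rewrite !mxE mulrDl mulrA.
  by rewrite b0 // b0' // mulr0 addr0.
have [p [D0 [D0free D0P PD0]]] := row_space_of_set P0 PL.
have [beta betaP] := choice D0P.
pose D g := \matrix_(i < p, k < r) beta i g 0 k.
have rowD i g : row i (D g) = beta i g by apply/rowP => k; rewrite !mxE.
have D1 : D 1%:M = D0.
  by apply/row_matrixP => i; rewrite rowD; have [_ <-] := betaP i.
have Do i k : orbitfun (fun g => D g i k).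
  apply: (@polyfun_ext _ _ _ _ _ (fun g => beta i g 0 k)); last by have [[]] := betaP i.
  by move=> g _; rewrite mxE.
(* If the coordinates of [a] were a combination of values at 1 of relations, subtracting the
   relations themselves would write [a] with coefficients beta(g) - beta(1), which lie in the fibre
   ideal. *)
have naD : ~~ (coords a <= D0)%MS.
  apply/negP => /submxP[w aE]; apply: na.
  apply: fibre_ideal_ext (subspaceZ (fibre_ideal_subspace G rho v) (-1)
    (subspace_sum (fibre_ideal_subspace G rho v) (index_enum 'I_p) (fun i => w 0 i)
      (y := fun i g => \sum_k z k g * (beta i g 0 k - beta i 1%:M 0 k)) _)).
    move=> g Gg; rewrite (coordsE ad Gg) aE mulN1r -sumrN.
    under [RHS]eq_bigr => k _ do rewrite !mxE mulr_suml.
    rewrite exchange_big; apply: eq_bigr => i _.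
    have [[_ b0] _] := betaP i.
    rewrite -mulrN -sumrN.
    transitivity (w 0 i * (\sum_k D0 i k * z k g - \sum_k beta i g 0 k * z k g)).
      congr (_ * _); rewrite -sumrB; apply: eq_bigr => k _.
      by rewrite -D1 !mxE; ring.
    by rewrite b0 // subr0 mulr_sumr; apply: eq_bigr => k _; rewrite mulrA.
  move=> i.
  apply: fibre_ideal_ext (subspace_sum (fibre_ideal_subspace G rho v) (index_enum 'I_r) (fun=> 1)
      (y := fun k g => z k g * (beta i g 0 k - beta i 1%:M 0 k)) _).
    by move=> g _; apply: eq_bigr => k _; rewrite mul1r.
  move=> k; apply: fibre_idealMl; first exact: regular_le_regular (zd k).
  by have [[bo _] _] := betaP i; apply: orbitfun_fibre.
have [mu0 [Dmu0 amu0]] := submx_separate naD.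
have [E0 DE0] := row_freeP D0free.
(* Cramer's rule without denominators: where delta is nonzero, [mu'] is delta times mu0 - E0
   Delta^-1 D mu0, a projection of mu0 to the kernel of D(g). *)
pose Delta g := D g *m E0.
pose delta g := \det (Delta g).
pose mu' g := delta g *: mu0 - E0 *m (\adj (Delta g) *m (D g *m mu0)).
have Deltao i j : orbitfun (fun g => Delta g i j).
  by apply: polyfun_mulmx => // ? ?; apply: polyfun_const.
have deltao : orbitfun delta by apply: polyfun_det.
have Delta1 : Delta 1%:M = 1%:M by rewrite /Delta D1.
(* The second factor delta makes the form vanish wherever D(g) may fail to span all relations at
   g. *)
exists (fun g => delta g *: mu' g); split.
- move=> k; apply: (@polyfun_ext _ _ _ _ _ (fun g => delta g * (delta g * mu0 k 0 -
     (E0 *m (\adj (Delta g) *m (D g *m mu0))) k 0))).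
    by move=> g _; rewrite !mxE.
  apply: polyfunM => //; apply: polyfunB.
    by apply: polyfunM => //; apply: polyfun_const.
  apply: polyfun_mulmx => [? ?|? ?]; first exact: polyfun_const.
  apply: polyfun_mulmx => [? ?|? ?]; first exact: polyfun_adj.
  by apply: polyfun_mulmx => // ? ?; apply: polyfun_const.
- move=> b g Gg brel; have [d0|d0] := eqVneq (delta g) 0.
    by rewrite d0 scale0r mulmx0.
  have Dmu' : D g *m mu' g = 0.
    rewrite /mu' mulmxBr -scalemxAr mulmxA -/(Delta g) mulmxA mul_mx_adj.
    by rewrite mul_scalar_mx subrr.
  have Dfree : row_free (D g).
    have DU : Delta g \in unitmx by rewrite unitmxE unitfE.
    apply/row_freeP; exists (E0 *m invmx (Delta g)).
    by rewrite mulmxA -/(Delta g) mulmxV.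
  (* Where delta is nonzero, D(g) has full row rank p. Translated to 1, all relations at g lie in
     the row space of D0, of rank at most p, so D(g) spans them. *)
  have sub : (col_mx (D g) (b g) *m T g <= D0)%MS.
    apply/row_subP => i; rewrite row_mul.
    have H beta' : relation beta' -> (beta' g *m T g <= D0)%MS.
      move=> rel; apply: PD0; exists (fun u => beta' (g *m u) *m T g).
      by split; [exact: relation_translate | rewrite mulmx1].
    rewrite -(splitK i); case: (split i) => j /=.
      by rewrite rowKu rowD; apply: H; have [] := betaP j.
    by rewrite rowKd (ord1 j) row_id; apply: H.
  have rk : (\rank (col_mx (D g) (b g)) <= \rank (D g))%N.
    rewrite -(mxrankMfree (col_mx (D g) (b g)) (B := T g)) ?row_free_unit ?T_unit //.
    by apply: leq_trans (mxrankS sub) _; rewrite (eqP Dfree) rank_leq_row.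
  have DgS : (D g <= col_mx (D g) (b g))%MS by rewrite -addsmxE addsmxSl.
  have bS : (b g <= col_mx (D g) (b g))%MS by rewrite -addsmxE addsmxSr.
  have /submxP[w ->] : (b g <= D g)%MS.
    apply: submx_trans bS _; rewrite -(geq_leqif (mxrank_leqif_sup DgS)) //.
  by rewrite -scalemxAr -mulmxA Dmu' mulmx0 scaler0.
- have -> : delta 1%:M = 1 by rewrite /delta Delta1 det1.
  by rewrite scale1r /mu' /delta Delta1 det1 scale1r D1 Dmu0 !mulmx0 subr0.
Qed.

End BoundedFunctional.
End OrbitFunctions.

(** * Descent of stabilizer-invariant functions to the orbit *)

(** The difference of the values at 2c and c, divided by c, kills the constant term and lowers the
    degree by one; the coefficients only acquire the factors 2^(k+1) - 1, which are nonzero. *)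
Lemma subspace_leading_coef (F : numFieldType) (S : Type) (X : set (S -> F)) n
    (a : nat -> S -> F) : is_subspace X ->
  (forall c : F, c != 0 -> X (fun s => \sum_(k < n.+1) c ^+ k * a k s)) -> X (a n).
Proof.
move=> subX; elim: n a => [|n IH] a Xa.
  apply: subspace_ext (Xa 1 (oner_neq0 _)) => s.
  by rewrite big_ord_recl big_ord0 addr0 mul1r.
pose b k s := (2 ^+ k.+1 - 1) * a k.+1 s.
have Xb : X (b n).
  apply: IH => c c0.
  have c20 : 2 * c != 0 by rewrite mulf_neq0 ?pnatr_eq0.
  apply: subspace_ext (subspaceZ subX c^-1 (subspaceB subX (Xa _ c20) (Xa _ c0))) => s.
  rewrite !(@big_ord_recl _ _ _ n.+1) !expr0 opprD addrACA subrr add0r -sumrB mulr_sumr.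
  apply: eq_bigr => k _; rewrite /b /bump /= exprMn [c ^+ k.+1]exprS.
  by field.
have e0 : (2 : F) ^+ n.+1 - 1 != 0.
  by rewrite subr_eq0 gt_eqF // exprn_egt1 // ltr1n.
by apply: subspace_ext (subspaceZ subX (2 ^+ n.+1 - 1)^-1 Xb) => s; rewrite /b mulKf.
Qed.

Section OrbitFunctions.
Variables (R : realType) (n : nat) (G : set 'M[R[i]]_n).
Hypothesis G_group : algebraic_group G.
Variables (m : nat) (rho : 'M[R[i]]_n -> 'M[R[i]]_m).
Hypothesis rho_rational : rational_rep G rho.
Variable v : 'cV[R[i]]_m.
Local Notation C := R[i].
Local Notation H := (rep_stabilizer G rho v).
Local Notation y := (orbit_coord rho v).
Local Notation orbitfun := (polyfun G y).
Local Notation fibre_ideal := (fibre_ideal G rho v).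
Local Notation stab_invariant := (stab_invariant G rho v).
Implicit Types (a b f : 'M[C]_n -> C).

Section Local.
Variable N : nat.
Hypothesis nilN : forall f, stab_invariant f ->
  fibre_ideal (fun g => (f g - f 1%:M) ^+ N.+1).

(* For a functional [p] as in [functional_extend], the sequence p(f^j) satisfies
   the linear recurrence with characteristic polynomial (X - f)^(N+1), whose
   coefficients are found by inverting a Hankel matrix with entries in the ring
   of functions on the orbit. *)
Lemma locally_orbitfun_maximal f : stab_invariant f -> f 1%:M = 0 ->
  ~ fibre_ideal (fun g => f g ^+ N) ->
  exists delta, [/\ orbitfun delta, delta 1%:M != 0 &
    orbitfun (fun g => delta g * f g)].
Proof.
move=> fI f1 fN; have [fr fH] := fI; have G1 := algebraic_group1 G_group.
have [d0 fd0] := regular_regular_le fr.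
have {d0 fd0} [df fd] : exists d, regular_le G d.+1 f.
  by exists d0; apply: regular_leW fd0.
have [D DP] := nilpotent_uniform G_group rho_rational nilN fI.
(* Large enough for the powers of f up to 2N + 2 and for the products of f^j, j at most N + 1, with
   the coefficients from [nilpotent_uniform]. *)
pose d := (D + (df * (N.+1 + N.+1)).+1)%N.
have fjd j : (j <= N.+1 + N.+1)%N -> regular_le G d (fun g => f g ^+ j).
  move=> jN; apply: regular_leW (regular_leX j fd); rewrite /d.
  by rewrite addnS ltnS; apply: leq_trans (leq_addl _ _); rewrite leq_mul2l jN orbT.
have efjd e j : (j <= N.+1)%N -> regular_le G D e ->
    regular_le G d (fun g => e g * f g ^+ j).
  move=> jN eD; apply: regular_leW (regular_leM eD (regular_leX j fd)); rewrite /d.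
  by rewrite leq_add2l ltnS leq_mul2l (leq_trans jN (leq_addr _ _)) orbT.
have [|r [z [t [zd Gt zt zE]]]] :=
  @regular_le_basis _ _ G d (regular_le G d) (regular_le_subspace _ _) => //.
have [|mu [muo mu0 mu1]] := functional_extend G_group rho_rational zd Gt zt zE (fjd N _) fN.
  by rewrite (leq_trans (leqnSn N)) // leq_addr.
(* The linear form given by [mu], evaluated at g. By the choice of [mu], p(f^N) does not vanish at
   1. *)
pose p x g := (coords t x *m mu g) 0 0.
have po x : orbitfun (p x).
  by apply: polyfun_mulmx => k l; [exact: polyfun_const | rewrite (ord1 l)].
pose pf j := p (fun g => f g ^+ j).
have rec g j : G g -> (j < N.+1)%N ->
    \sum_(l < N.+2) (- f g) ^+ (N.+1 - l) *+ 'C(N.+1, l) * pf (j + l)%N g = 0.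
  move=> Gg jN; have [e [eD eE]] := DP g Gg.
  pose c l := (- f g) ^+ (N.+1 - l) *+ 'C(N.+1, l).
  (* The identity f^j ((f - f(g))^(N+1) - sum of (y_i - y_i(g)) e_i) = 0 read as a relation in u. At
     u = g the second sum drops out, and applying p there gives the recurrence. *)
  pose beta u := \sum_(l < N.+2) c l *: coords t (fun g => f g ^+ (j + l)) -
    \sum_i (y u i - y g i) *: coords t (fun g => e i g * f g ^+ j).
  have rel : relation G rho v z beta.
    split=> [k|u Gu].
      apply: (@polyfun_ext _ _ _ _ _ (fun u => (\sum_(l < N.+2) c l *: coords t (fun g => f g ^+ (j + l))) 0 k -
        \sum_i (y u i - y g i) * (coords t (fun g => e i g * f g ^+ j)) 0 k)).
        move=> u _; rewrite /beta [in RHS]mxE [in X in _ = _ + X]mxE !summxE.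
        by congr (_ - _); apply: eq_bigr => i _; rewrite [in RHS]mxE.
      apply: polyfunB; first exact: polyfun_const.
      apply: polyfun_sum => i; apply: polyfunM; last exact: polyfun_const.
      by apply: polyfunB; [exact: polyfun_coord | exact: polyfun_const].
    transitivity (\sum_(l < N.+2) c l * f u ^+ (j + l) -
        \sum_i (y u i - y g i) * (e i u * f u ^+ j)).
      transitivity (\sum_(l < N.+2) c l * (\sum_k coords t (fun g => f g ^+ (j + l)) 0 k * z k u) -
        \sum_i (y u i - y g i) * (\sum_k coords t (fun g => e i g * f g ^+ j) 0 k * z k u)).
        under [X in _ = X - _]eq_bigr => l _ do rewrite mulr_sumr.
        under [X in _ = _ - X]eq_bigr => i _ do rewrite mulr_sumr.
        rewrite exchange_big [X in _ = _ - X]exchange_big -sumrB.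
        apply: eq_bigr => k _; rewrite /beta [X in X * _]mxE [X in _ + X]mxE !summxE mulrBl !mulr_suml.
        by congr (_ - _); apply: eq_bigr => l _; rewrite [X in X * _]mxE mulrA.
      congr (_ - _); apply: eq_bigr => l _; rewrite -(coordsE zE _ Gu) //.
        by apply: fjd; have := ltn_ord l; lia.
      by apply: efjd => //; apply: ltnW.
    transitivity (f u ^+ j * ((f u - f g) ^+ N.+1 - \sum_i (y u i - y g i) * e i u)); last first.
      by rewrite eE // subrr mulr0.
    rewrite mulrBr [f u - _]addrC exprDn !mulr_sumr; congr (_ - _).
      by apply: eq_bigr => l _; rewrite /c exprD mulrnAr mulrnAl mulrCA.
    by apply: eq_bigr => i _; rewrite mulrA mulrC.
  have := congr1 (fun A : 'M_1 => A 0 0) (mu0 _ _ Gg rel).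
  rewrite /beta [X in _ - X]big1 => [|i _]; last by rewrite subrr scale0r.
  rewrite subr0 mulmx_suml summxE [RHS]mxE => E; rewrite -[RHS]E.
  by apply: eq_bigr => l _; rewrite -scalemxAl [RHS]mxE.
pose M g := \matrix_(j < N.+1, k < N.+1) pf (j + k)%N g.
have Mo j k : orbitfun (fun g => M g j k).
  by apply: (@polyfun_ext _ _ _ _ _ (pf (j + k)%N)) => [g _|]; [rewrite mxE | exact: po].
pose b g := \col_(j < N.+1) pf (j + N.+1)%N g.
have bo j k : orbitfun (fun g => b g j k).
  by apply: (@polyfun_ext _ _ _ _ _ (pf (j + N.+1)%N)) => [g _|]; [rewrite mxE | exact: po].
exists (fun g => \det (M g)); split; first exact: polyfun_det.
  (* As f(1) = 0, the recurrence at 1 says that p(f^i) vanishes there for N < i <= 2N, while p(f^N)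
     does not. *)
  apply: (@det_hankel_neq0 _ N (fun j => pf j 1%:M)) => // i /andP[Ni iN].
  have jN : (i - N.+1 < N.+1)%N by lia.
  have := rec 1%:M _ G1 jN; rewrite f1 oppr0 big_ord_recr /= big1 => [|l _].
    by rewrite add0r subnn expr0 binn mulr1n mul1r subnK.
  by rewrite expr0n subn_eq0 leqNgt ltn_ord /= mul0rn mul0r.
(* The recurrences form the system M gam = - b, where the last entry of gam is -(N+1) f. Multiplying
   by the adjugate gives det(M) f after division by N + 1, which is possible in characteristic
   zero. *)
apply: (@polyfun_ext _ _ _ _ _ (fun g => N.+1%:R^-1 * (\adj (M g) *m b g) ord_max 0)).
  move=> g Gg; pose gam := \col_(k < N.+1) ((- f g) ^+ (N.+1 - k) *+ 'C(N.+1, k)).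
  have Mg : M g *m gam = - b g.
    apply/colP => j; rewrite !mxE; apply/eqP; rewrite -subr_eq0 opprK.
    rewrite -[X in _ == X](rec g j Gg (ltn_ord j)) [in X in _ == X]big_ord_recr /=.
    rewrite subnn expr0 binn mulr1n mul1r; apply/eqP; congr (_ + _).
    by apply: eq_bigr => k _; rewrite !mxE mulrC.
  have := congr1 (fun A : 'cV_ _ => A ord_max 0) (congr1 (mulmx (\adj (M g))) Mg).
  rewrite mulmxA mul_adj_mx mul_scalar_mx mulmxN [in X in X = _ -> _]mxE [in X in _ = X -> _]mxE.
  have -> : gam ord_max 0 = - (N.+1%:R * f g).
    by rewrite mxE /= subSnn expr1 binSn -mulr_natl mulrN.
  rewrite mulrN => /oppr_inj <-.
  by rewrite mulrCA mulKf // pnatr_eq0.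
apply: polyfunZ; apply: polyfun_mulmx => [? ?|//]; exact: polyfun_adj.
Qed.

Lemma stab_invariant_lin c f0 f : stab_invariant f0 -> stab_invariant f ->
  stab_invariant (fun g => f g - f 1%:M + c * (f0 g - f0 1%:M)).
Proof.
move=> [r0 H0] [fr fH]; split=> [|g h Gg Hh]; last by rewrite H0 ?fH.
apply: polyfunD; first by apply: polyfunB => //; apply: polyfun_const.
by apply: polyfunZ; apply: polyfunB => //; apply: polyfun_const.
Qed.

(** Put e = f0 - f0(1), for which e^N is not in the fibre ideal. For some constant c the N-th power
    of f - f(1) + c e is not there either, since otherwise its leading coefficient e^N in c would
    be. The case of maximal nilpotency order then applies to this function and to e, and f is
    recovered from the two. *)
Lemma locally_orbitfun f0 f : stab_invariant f0 ->
  ~ fibre_ideal (fun g => (f0 g - f0 1%:M) ^+ N) -> stab_invariant f ->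
  exists delta, [/\ orbitfun delta, delta 1%:M != 0 &
    orbitfun (fun g => delta g * f g)].
Proof.
move=> f0I nf0 fI; pose e g := f0 g - f0 1%:M.
have eI : stab_invariant e.
  have [r0 H0] := f0I; split=> [|g h Gg Hh]; last by rewrite /e H0.
  by apply: polyfunB => //; apply: polyfun_const.
have [c nc] : exists c, ~ fibre_ideal (fun g => (f g - f 1%:M + c * e g) ^+ N).
  apply: contrapT => nex; apply: nf0.
  pose a k g := (f g - f 1%:M) ^+ (N - k) * e g ^+ k *+ 'C(N, k).
  apply: fibre_ideal_ext (subspace_leading_coef (n := N) (a := a)
      (fibre_ideal_subspace G rho v) _) => [g _|c _].
    by rewrite /a subnn expr0 mul1r binn mulr1n.
  have /contrapT := fun nc => nex (ex_intro _ c nc); apply: fibre_ideal_ext => g _.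
  rewrite exprDn; apply: eq_bigr => k _.
  by rewrite /a exprMn mulrnAr; congr (_ *+ _); rewrite mulrCA.
have [||d1 [d1o d11 d1f]] := locally_orbitfun_maximal (stab_invariant_lin c f0I fI).
- by rewrite !subrr mulr0 addr0.
- exact: nc.
have [||d2 [d2o d21 d2f]] := locally_orbitfun_maximal eI.
- by rewrite /e subrr.
- exact: nf0.
exists (fun g => d1 g * d2 g); split; [exact: polyfunM | exact: mulf_neq0|].
apply: (@polyfun_ext _ _ _ _ _ (fun g => d2 g * (d1 g * (f g - f 1%:M + c * (f0 g - f0 1%:M))) -
    c * (d1 g * (d2 g * e g)) + f 1%:M * (d1 g * d2 g))).
  by move=> g _; rewrite /e; ring.
apply: polyfunD; last by apply: polyfunZ; apply: polyfunM.
by apply: polyfunB; [|apply: polyfunZ]; apply: polyfunM.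
Qed.

End Local.

(* In characteristic zero the orbit map is a quotient by the stabilizer. *)
Lemma stab_invariant_orbitfun f :
  zariski_closed (rep_orbit G rho v) -> stab_invariant f -> orbitfun f.
Proof.
move=> [S orbitE] fI.
have G1 := algebraic_group1 G_group; have GV := algebraic_groupV G_group.
(* The least uniform exponent exists by [stabilizer_nilpotent]. It is positive, because functions in
   the fibre ideal vanish at 1 and a zeroth power does not. *)
have [|[|N] [nilN minN]] := @nat_least (fun N => forall f, stab_invariant f ->
    fibre_ideal (fun g => (f g - f 1%:M) ^+ N)).
- have [s sP] := stabilizer_nilpotent G_group rho_rational v; exists s => f' [fr fH].
  apply: (sP (fun g => f' g - f' 1%:M)).
    by apply: polyfunB => //; apply: polyfun_const.
  by move=> h Hh; rewrite -[h]mul1mx fH // subrr.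
- have /nilN/(fibre_ideal1 G_group rho_rational) : stab_invariant (fun=> 0).
    by split=> //; apply: polyfun_const.
  by move/eqP; rewrite oner_eq0.
have [f0 [f0I nf0]] : exists f0, stab_invariant f0 /\
    ~ fibre_ideal (fun g => (f0 g - f0 1%:M) ^+ N).
  apply: contrapT => nex; have : (N.+1 <= N)%N.
    apply: minN => f0 f0I; apply: contrapT => nf0; apply: nex; by exists f0.
  by rewrite ltnn.
(* The ideal of denominators of f. The equations of the orbit belong to it, so a common zero would
   be a point g v of the orbit; translating a local denominator from 1 to g gives an element nonzero
   at that point. Hence 1 is a denominator. *)
pose I := [set q : {mpoly C[m]} | orbitfun (fun g => q.@[y g] * f g)].
have idI : is_ideal I.
  split=> [|q1 q2 I1 I2|a q Iq] /=.
  - apply: polyfun_ext (polyfun_const _ _ 0) => g _; by rewrite meval0 mul0r.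
  - by apply: polyfun_ext (polyfunD I1 I2) => g _; rewrite mevalD mulrDl.
  - have ao : orbitfun (fun g => a.@[y g]) by exists a.
    by apply: polyfun_ext (polyfunM ao Iq) => g _; rewrite mevalM mulrA.
have [a aI|s] := @nullstellensatz R m I 1 idI; last first.
  by rewrite expr1n; apply: polyfun_ext => g _; rewrite meval1 mul1r.
have [g Gg ga] : rep_orbit G rho v (\col_i a i).
  rewrite orbitE => q Sq; rewrite /peval -(aI q).
    by apply: meval_eq => i; rewrite mxE.
  apply: polyfun_ext (polyfun_const _ _ 0) => g Gg.
  have : rep_orbit G rho v (rho g *m v) by exists g.
  by rewrite orbitE => /(_ q Sq); rewrite /peval => ->; rewrite mul0r.
have ya i : y g i = a i by rewrite /orbit_coord ga mxE.
have [d [dorb d1 df]] := locally_orbitfun nilN f0I nf0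
  (stab_invariant_mull G_group Gg fI).
have gU := group_unitmx G_group Gg.
have [q qE] := orbitfun_mull G_group rho_rational (GV _ Gg) dorb.
have : q.@[a] = 0.
  apply: aI; apply: polyfun_ext (orbitfun_mull G_group rho_rational (GV _ Gg) df) => u Gu.
  by rewrite qE // mulKVmx.
rewrite -(meval_eq q ya) -qE // mulVmx // => d0.
by move: d1; rewrite d0 eqxx.
Qed.

End OrbitFunctions.

(** * Homogeneous invariants and Hilbert's finiteness theorem *)

Lemma horner_eq0 (F : numFieldType) (p : {poly F}) : (forall c, p.[c] = 0) -> p = 0.
Proof.
move=> p0; apply/eqP; apply: contrapT => /negP pn0.
have := max_poly_roots (rs := [seq i%:R | i <- iota 0 (size p)]) pn0.
rewrite size_map size_iota ltnn => H.
suff : false by []; apply: H; first by apply/allP => c _; apply/rootP.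
by rewrite map_inj_uniq ?iota_uniq // => i j /eqP; rewrite eqr_nat => /eqP.
Qed.

Lemma least_le (P : nat -> Prop) D : P D -> P (least P) /\ (least P <= D)%N.
Proof.
move=> PD; have [d [Pd mind]] := nat_least (ex_intro _ D PD).
have [Pl minl] : [set D | P D /\ forall D', P D' -> (D <= D')%N] (least P).
  exact: (@xgetI _ 0%N _ d).
by split=> //; apply: minl.
Qed.

Section InSubalgebra.
Variables (R : realType) (m : nat).
Local Notation C := R[i].
Variable S : set {mpoly C[m]}.

Lemma in_subalgebra_gen f : S f -> in_subalgebra S f.
Proof.
move=> Sf; exists 1%N, [tuple f], 'X_ord0; split=> [i|].
  by rewrite (ord1 i) (tnth_nth 0).
by rewrite comp_mpolyXU.
Qed.

Lemma in_subalgebraC c : in_subalgebra S c%:MP.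
Proof.
by exists 0%N, [tuple], c%:MP; split=> [[]//|]; rewrite comp_mpolyC.
Qed.

Lemma in_subalgebra_pair f g : in_subalgebra S f -> in_subalgebra S g ->
  exists l (t : l.-tuple {mpoly C[m]}) p q,
    [/\ forall i, S (tnth t i), f = p \mPo t & g = q \mPo t].
Proof.
move=> [a [t [p [tS ->]]]] [b [u [q [uS ->]]]].
exists (a + b)%N, (cat_tuple t u).
exists (p \mPo [tuple 'X_(lshift b i) | i < a]), (q \mPo [tuple 'X_(rshift a i) | i < b]).
split=> [i||].
- by rewrite -(splitK i); case: (split i) => j /=; rewrite ?tnth_lshift ?tnth_rshift.
- apply: meval_inj => z; rewrite !comp_mpoly_meval; apply: meval_eq => i.
  by rewrite tnth_mktuple mevalXU tnth_lshift.
- apply: meval_inj => z; rewrite !comp_mpoly_meval; apply: meval_eq => i.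
  by rewrite tnth_mktuple mevalXU tnth_rshift.
Qed.

Lemma in_subalgebraD f g : in_subalgebra S f -> in_subalgebra S g -> in_subalgebra S (f + g).
Proof.
move=> Sf Sg; have [l [t [p [q [tS -> ->]]]]] := in_subalgebra_pair Sf Sg.
by exists l, t, (p + q); split=> //; rewrite comp_mpolyD.
Qed.

Lemma in_subalgebraM f g : in_subalgebra S f -> in_subalgebra S g -> in_subalgebra S (f * g).
Proof.
move=> Sf Sg; have [l [t [p [q [tS -> ->]]]]] := in_subalgebra_pair Sf Sg.
by exists l, t, (p * q); split=> //; rewrite rmorphM.
Qed.

Lemma in_subalgebra_sum (T : Type) (r : seq T) (f : T -> {mpoly C[m]}) :
  (forall i, in_subalgebra S (f i)) -> in_subalgebra S (\sum_(i <- r) f i).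
Proof.
move=> Sf; apply: big_ind => // [|? ? ? ?]; last exact: in_subalgebraD.
exact: in_subalgebraC 0.
Qed.

Lemma in_subalgebra_comp l (p : {mpoly C[l]}) (t : l.-tuple {mpoly C[m]}) :
  (forall i, in_subalgebra S (tnth t i)) -> in_subalgebra S (p \mPo t).
Proof.
move=> St; rewrite comp_mpolyEX; apply: in_subalgebra_sum => e.
rewrite -mul_mpolyC; apply: in_subalgebraM; first exact: in_subalgebraC.
rewrite comp_mpolyX; apply: big_ind => // [|? ? ? ?|i _]; last 2 first.
- exact: in_subalgebraM.
- elim: (e i) => [|j IH]; first by rewrite expr0; apply: in_subalgebraC 1.
  by rewrite exprS; apply: in_subalgebraM.
exact: in_subalgebraC 1.
Qed.

End InSubalgebra.

Section Homogeneous.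
Variables (R : realType) (m : nat).
Local Notation C := R[i].
Implicit Types (f h : {mpoly C[m]}).

Lemma dhomog_peval d f c z : f \is d.-homog -> peval f (c *: z) = c ^+ d * peval f z.
Proof.
move=> /dhomogP fd; rewrite /peval !mevalE mulr_sumr.
rewrite big_seq [RHS]big_seq; apply: eq_bigr => e /fd /= <-.
rewrite mulrCA mdegE -prodrXr -big_split /=; congr (_ * _).
by apply: eq_bigr => i _; rewrite mxE exprMn.
Qed.

Lemma peval_pihomog d f c z : (msize f <= d)%N ->
  peval f (c *: z) = \sum_(e < d) c ^+ e * peval (pihomog mdeg e f) z.
Proof.
move=> fd; rewrite {1}(pihomog_partitionE fd) {1}/peval raddf_sum.
by apply: eq_bigr => e _; rewrite -(dhomog_peval _ _ (pihomogP _ _ _)).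
Qed.

Lemma pihomogM d e h f : f \is e.-homog ->
  pihomog mdeg d (h * f) = if (e <= d)%N then pihomog mdeg (d - e) h * f else 0.
Proof.
move=> fe; have [de|ed] := leqP e d.
  have hN : (msize h <= msize h + d.+1)%N by apply: leq_addr.
  rewrite {1}(pihomog_partitionE hN) mulr_suml raddf_sum /=.
  have dN : (d - e < msize h + d.+1)%N by lia.
  rewrite (bigD1 (Ordinal dN)) //= big1 ?addr0 => [|i ni].
    rewrite pihomog_dE // -{2}(subnK de).
    by apply: dhomogM => //; apply: pihomogP.
  apply: (@pihomog_ne0 _ _ _ (i + e)%N); last by apply: dhomogM => //; apply: pihomogP.
  apply: contra ni => /eqP E; apply/eqP/val_inj => /=; lia.
rewrite {1}(pihomog_partitionE (leqnn (msize h))) mulr_suml raddf_sum /= big1 // => i _.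
apply: (@pihomog_ne0 _ _ _ (i + e)%N); last by apply: dhomogM => //; apply: pihomogP.
by apply/eqP; lia.
Qed.

Lemma dhomog0_const f : f \is 0.-homog -> f = (f@_0%MM)%:MP.
Proof.
move=> /dhomogP f0; apply: msize1_polyC; rewrite msizeE.
by apply/bigmax_leqP_seq => e /f0 /= ->.
Qed.

Variables (n : nat) (G : set 'M[C]_n) (rho : 'M[C]_n -> 'M[C]_m).

(** The action is linear, so the invariance of f at c z, compared coefficient by coefficient in c,
    is the invariance of all components. *)
Lemma pihomog_invariant d f : is_invariant G rho f ->
  homog_invariant G rho d (pihomog mdeg d f).
Proof.
move=> finv; split; last exact: pihomogP.
move=> g Gg z; pose N := (msize f + d.+1)%N.
have fN : (msize f <= N)%N by apply: leq_addr.
pose p := \poly_(e < N) (peval (pihomog mdeg e f) (rho g *m z) - peval (pihomog mdeg e f) z).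
have : p = 0.
  apply: horner_eq0 => c; rewrite horner_poly.
  under eq_bigr => e _ do rewrite mulrBl mulrC [X in _ - X]mulrC.
  by rewrite sumrB -!peval_pihomog // scalemxAr finv // subrr.
move=> /(congr1 (fun p : {poly C} => p`_d)); rewrite coef_poly coef0.
have -> : (d < N)%N by rewrite /N; lia.
by move/eqP; rewrite subr_eq0 => /eqP.
Qed.

End Homogeneous.

Section HilbertFiniteness.
Variables (R : realType) (n : nat) (G : set 'M[R[i]]_n).
Hypothesis G_reductive : reductive G.
Variables (m : nat) (rho : 'M[R[i]]_n -> 'M[R[i]]_m).
Hypothesis rho_rational : rational_rep G rho.
Local Notation C := R[i].
Local Notation homog_inv := (homog_invariant G rho).

(** Applying a group element changes the tuple of coefficients by a syzygy of the f_i, and the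
    syzygies form a stable space; so [invariant_lift] makes the coefficients invariant. Taking
    components of the right degree keeps the identity. *)
Lemma homog_invariant_lift r (f : 'I_r -> {mpoly C[m]}) (e : 'I_r -> nat) d F
    (h : 'I_r -> {mpoly C[m]}) :
  (forall i, homog_inv (e i) (f i)) -> homog_inv d F -> F = \sum_i h i * f i ->
  exists h', F = \sum_i h' i * f i /\
    forall i, if (e i <= d)%N then homog_inv (d - e i) (h' i) else h' i = 0.
Proof.
move=> fe [FI Fd] FE.
pose K : set ('I_r * 'cV[C]_m -> C) :=
  [set u | forall z, \sum_i u (i, z) * peval (f i) z = 0].
have subK : is_subspace K.
  split=> [z|c u w Ku Kw z]; first by rewrite big1 // => i _; rewrite mul0r.
  transitivity (c * (\sum_i u (i, z) * peval (f i) z) + \sum_i w (i, z) * peval (f i) z).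
    by rewrite mulr_sumr -big_split; apply: eq_bigr => i _; rewrite mulrDl mulrA.
  by rewrite Ku Kw mulr0 addr0.
have FEz z : peval F z = \sum_i peval (h i) z * peval (f i) z.
  by rewrite FE /peval raddf_sum; apply: eq_bigr => i _; rewrite /= mevalM.
have [|g Gg z /=|h' [h'I Kh']] := invariant_lift G_reductive rho_rational (x := h) subK.
- move=> g u Gg Ku z /=; rewrite -[RHS](Ku (rho g *m z)).
  by apply: eq_bigr => i _; have [fI _] := fe i; rewrite fI.
- under eq_bigr => i _ do rewrite mulrBl.
  rewrite sumrB -FEz -(FI g Gg z) FEz -sumrB big1 // => i _.
  by have [fI _] := fe i; rewrite fI // subrr.
have FE' : F = \sum_i h' i * f i.
  apply: peval_inj => z; have := Kh' z => /= /eqP.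
  under eq_bigr => i _ do rewrite mulrBl.
  rewrite sumrB -FEz subr_eq0 => /eqP ->.
  by rewrite /peval raddf_sum; apply: eq_bigr => i _; rewrite /= mevalM.
exists (fun i => if (e i <= d)%N then pihomog mdeg (d - e i) (h' i) else 0).
split=> [|i]; last by case: ifP => [eid|->] //; rewrite eid; apply: pihomog_invariant.
rewrite -[LHS](pihomog_dE Fd) FE' raddf_sum; apply: eq_bigr => i _ /=.
have [_ fd] := fe i; rewrite (pihomogM _ _ fd).
by case: ifP => // _; rewrite mul0r.
Qed.

(** [Q] is used both for all positive degrees and for the degrees from 1 to D. *)
Lemma homog_invariant_generators (Q : nat -> Prop) :
  exists (s : seq {mpoly C[m]}) (e : 'I_(size s) -> nat),
  (forall i, Q (e i) /\ homog_inv (e i) s`_i) /\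
  forall d x, Q d -> homog_inv d x -> gen_ideal s x.
Proof.
have [s [sQ Qs]] := hilbert_basis [set x | exists2 d, Q d & homog_inv d x].
have H (i : 'I_(size s)) : exists d, Q d /\ homog_inv d s`_i.
  by have [d Qd hd] := sQ _ (mem_nth 0 (ltn_ord i)); exists d.
have [e eP] := choice H.
by exists s, e; split=> // d x Qd xd; apply: Qs; exists d.
Qed.

(** Hilbert's argument: generators of the ideal spanned by the invariants of positive degree also
    generate the algebra, by induction on the degree, since the coefficients can be chosen invariant
    of smaller degree. *)
Lemma hilbert_finiteness : exists D, generated_in_degree G rho D.
Proof.
have [s [e [sP gen]]] := homog_invariant_generators (fun d => (0 < d)%N).
pose D := \max_i e i; exists D.
rewrite /generated_in_degree; set S := (X in in_subalgebra X).
have homogS d x : homog_inv d x -> in_subalgebra S x.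
  have [N] := ubnP d; elim: N => // N IH in d x * => dN xd.
  have [d0|d0] := posnP d.
    by move: xd; rewrite d0 => -[_ /dhomog0_const ->]; apply: in_subalgebraC.
  have [c xE] := gen _ _ d0 xd.
  have [h [-> hP]] := homog_invariant_lift (fun i => (sP i).2) xd xE.
  apply: in_subalgebra_sum => i; have [ei0 si] := sP i; apply: in_subalgebraM.
    have := hP i; case: ifP => [eid hi|_ ->]; last exact: in_subalgebraC 0.
    apply: IH hi; move: ei0 dN eid; lia.
  by apply: in_subalgebra_gen; exists (e i) => //; apply: leq_bigmax.
move=> f finv; rewrite (pihomog_partitionE (leqnn (msize f))).
by apply: in_subalgebra_sum => d; apply: homogS; apply: pihomog_invariant.
Qed.

Lemma null_cone_finiteness : exists D, null_cone_cut_in_degree G rho D.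
Proof.
have [s [e [sP gen]]] := homog_invariant_generators (fun d => (0 < d)%N).
exists (\max_i e i); apply/seteqP; split=> z zP f.
  by move=> [d /andP[d0 _] fd]; apply: zP; exists d.
move=> [d d0 fd]; have [c ->] := gen _ _ d0 fd.
rewrite /peval raddf_sum big1 // => i _ /=; have [ei0 si] := sP i.
rewrite mevalM; have := zP s`_i; rewrite /peval => ->; rewrite ?mulr0 //.
by exists (e i) => //; rewrite ei0; apply: leq_bigmax.
Qed.

End HilbertFiniteness.

(** * Restriction to the fibre over v *)

Section Restriction.
Variables (R : realType) (m k : nat) (v : 'cV[R[i]]_m).
Local Notation C := R[i].

Definition restrict_at (f : {mpoly C[m + k]}) : {mpoly C[k]} :=
  f \mPo [tuple match split i with inl j => (v j 0)%:MP | inr j => 'X_j end | i < m + k].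

Lemma restrictE f w : peval (restrict_at f) w = peval f (col_mx v w).
Proof.
rewrite /peval comp_mpoly_meval; apply: meval_eq => i.
rewrite tnth_mktuple mxE; case: (split i) => j; first by rewrite mevalC.
by rewrite mevalXU.
Qed.

Lemma msize_restrict f : (msize (restrict_at f) <= msize f)%N.
Proof.
apply: msize_comp_affine => i; rewrite tnth_mktuple.
case: (split i) => j; last by rewrite msizeX mdeg1.
by rewrite msizeC; apply: leq_trans (leq_b1 _) _.
Qed.

Lemma peval_lshift (q : {mpoly C[m]}) (x : 'cV[C]_m) (w : 'cV[C]_k) :
  peval (q \mPo [tuple 'X_(lshift k i) | i < m]) (col_mx x w) = peval q x.
Proof.
rewrite /peval comp_mpoly_meval; apply: meval_eq => i.
by rewrite tnth_mktuple mevalXU col_mxEu.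
Qed.

Lemma peval_rshift (q : {mpoly C[k]}) (x : 'cV[C]_m) (w : 'cV[C]_k) :
  peval (q \mPo [tuple 'X_(rshift m i) | i < k]) (col_mx x w) = peval q w.
Proof.
rewrite /peval comp_mpoly_meval; apply: meval_eq => i.
by rewrite tnth_mktuple mevalXU col_mxEd.
Qed.

End Restriction.

Section DirectSum.
Variables (R : realType) (n : nat) (G : set 'M[R[i]]_n).
Variables (m k : nat).
Variables (rhoV : 'M[R[i]]_n -> 'M[R[i]]_m) (rhoW : 'M[R[i]]_n -> 'M[R[i]]_k).
Hypothesis rhoV_rational : rational_rep G rhoV.
Hypothesis rhoW_rational : rational_rep G rhoW.
Local Notation C := R[i].
Local Notation rho := (dsum_rep rhoV rhoW).

Lemma dsum_repE g (x : 'cV[C]_m) (w : 'cV[C]_k) : rho g *m col_mx x w = col_mx (rhoV g *m x) (rhoW g *m w).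
Proof. by rewrite mul_block_col !mul0mx addr0 add0r. Qed.

Lemma dsum_rep_rational : rational_rep G rho.
Proof.
have reg0 : regular_fun G (fun=> 0).
  by exists 0, 0%N => g _; rewrite /peval meval0 mul0r.
split=> [|g h Gg Gh|i j].
- by rewrite /dsum_rep (rational_rep1 rhoV_rational) (rational_rep1 rhoW_rational) -scalar_mx_block.
- rewrite /dsum_rep (rational_repM rhoV_rational) // (rational_repM rhoW_rational) //.
  by rewrite mulmx_block !mul0mx !mulmx0 !addr0 !add0r.
- rewrite -(splitK i) -(splitK j); case: (split i) => i'; case: (split j) => j' /=.
  + have [p [e E]] := rational_rep_regular rhoV_rational i' j'.
    by exists p, e => g Gg; rewrite block_mxEul E.
  + have [p [e E]] := reg0; exists p, e => g Gg.
    by rewrite block_mxEur mxE -(E g Gg).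
  + have [p [e E]] := reg0; exists p, e => g Gg.
    by rewrite block_mxEdl mxE -(E g Gg).
  + have [p [e E]] := rational_rep_regular rhoW_rational i' j'.
    by exists p, e => g Gg; rewrite block_mxEdr E.
Qed.

Variable v : 'cV[C]_m.
Local Notation H := (rep_stabilizer G rhoV v).

Lemma restrict_invariant f : is_invariant G rho f -> is_invariant H rhoW (restrict_at v f).
Proof.
move=> finv h [Gh hv] w.
by rewrite !restrictE -{1}hv -dsum_repE finv.
Qed.

Hypothesis G_reductive : reductive G.
Hypothesis orbit_closed : zariski_closed (rep_orbit G rhoV v).

Lemma restrict_surjective h : is_invariant H rhoW h ->
  exists f, is_invariant G rho f /\ restrict_at v f = h.
Proof.
move=> hinv; have [G_group _] := G_reductive.
have G1 := algebraic_group1 G_group.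
have GM := algebraic_groupM G_group; have GV := algebraic_groupV G_group.
pose F g w := peval h (rhoW (invmx g) *m w).
have Ftrans g g' w : G g -> G g' -> F (g' *m g) (rhoW g' *m w) = F g w.
  move=> Gg Gg'; rewrite /F mulmxA -(rational_repM rhoW_rational) //; last exact/GV/GM.
  by rewrite invmx_mul ?mulmxKV //; apply: group_unitmx G_group _ _.
(* The bound is independent of w, so all the functions F(-, w) lie in one finite-dimensional
   space. *)
have [d Fd] : exists d, forall w, regular_le G d (fun g => F g w).
  have P ij : exists P : {mpoly C[(n * n).+1]}, forall g, G g ->
      rhoW (invmx g) ij.1 ij.2 = P.@[glcoord g].
    apply: (regular_inv G_group (a := fun g => rhoW g ij.1 ij.2)).
    exact/regular_fun_regular/(rational_rep_regular rhoW_rational).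
  have {P} [P PE] := choice P.
  pose d := \max_ij msize (P ij).
  exists (d * msize h).+1 => w.
  exists (h \mPo [tuple \sum_j w j 0 *: P (i, j) | i < k]); split=> [|g Gg].
    apply: msize_comp_le => // i; rewrite tnth_mktuple.
    apply: leq_trans (msize_sum _ _ _) _; apply/bigmax_leqP_seq => j _ _.
    apply: leq_trans (msizeZ_le _ _) _; apply: leqW.
    by rewrite /d (leq_bigmax (F := fun ij => msize (P ij)) (i, j)).
  rewrite comp_mpoly_meval /F /peval; apply: meval_eq => i.
  rewrite tnth_mktuple mxE raddf_sum; apply: eq_bigr => j _ /=.
  by rewrite mevalZ -PE // mulrC.
pose X a := regular_le G d a /\ stab_invariant G rhoV v a.
have subX : is_subspace X.
  have s1 := regular_le_subspace G d.
  split=> [|c a b [a1 [a2 a3]] [b1 [b2 b3]]].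
    split; first exact: subspace0 s1.
    by split=> //; apply: polyfun_const.
  split; first exact: subspaceP s1 _ _ _ _ _.
  split=> [|g h' Gg Hh']; last by rewrite a3 ?b3.
  by apply: polyfunD => //; apply: polyfunZ.
have XF w : X (fun g => F g w).
  split=> //; split=> [|g h' Gg [Gh' h'v]]; first exact: regular_le_regular (Fd w).
  have Hh : H (invmx h').
    split; first exact: GV.
    rewrite -{1}h'v mulmxA -(rational_repM rhoV_rational) //; last exact: GV.
    rewrite mulVmx ?(rational_rep1 rhoV_rational) ?mul1mx //.
    exact: group_unitmx G_group _ Gh'.
  have gU := group_unitmx G_group Gg; have hU := group_unitmx G_group Gh'.
  rewrite /F invmx_mul // (rational_repM rhoW_rational); [|exact: GV..].
  by rewrite -mulmxA hinv.
have [|r [z [t [Xz Gt _ XE]]]] := @regular_le_basis _ _ G d X subX.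
  by move=> a [].
have qex i : polyfun G (orbit_coord rhoV v) (z i).
  by have [_ ?] := Xz i; exact: stab_invariant_orbitfun.
have {qex} [q qE] := choice qex.
have hex i : exists p : {mpoly C[k]}, (msize p <= msize h)%N /\
    forall w, peval p w = peval h (rhoW (invmx (t i)) *m w).
  exact: peval_mulmx.
have {hex} [p pE] := choice hex.
(* Expansion of F(-, w) in a basis dual to the points t_i: the basis functions descend to
   polynomials q_i on the orbit, and the coefficients F(t_i, w) are polynomials in w. *)
pose F0 : {mpoly C[m + k]} := \sum_i (q i \mPo [tuple 'X_(lshift k j) | j < m]) *
  (p i \mPo [tuple 'X_(rshift m j) | j < k]).
have F0E g w : G g -> peval F0 (col_mx (rhoV g *m v) w) = F g w.
  move=> Gg; rewrite (XE _ (XF w) g Gg) {1}/peval raddf_sum; apply: eq_bigr => i _ /=.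
  rewrite mevalM -!/(peval _ _) peval_lshift peval_rshift (pE i).2 mulrC.
  by rewrite (qE i g Gg).
(* The functions that vanish on the product of the orbit and W. Modulo these [F0] is invariant, and
   altering it by one of them does not change its restriction at v. *)
pose K : set ('I_1 * 'cV[C]_(m + k) -> C) :=
  [set u | forall i g w, G g -> u (i, col_mx (rhoV g *m v) w) = 0].
have [|g' u Gg' Ku|g' Gg'|f [finv Kf]] :=
    invariant_lift G_reductive dsum_rep_rational (r := 1) (x := fun=> F0) (K := K).
- split=> [//|c a b Ka Kb i g w Gg].
  by rewrite Ka // Kb // mulr0 addr0.
- move=> i g w Gg /=; rewrite dsum_repE mulmxA -(rational_repM rhoV_rational) //.
  by apply: Ku; apply: GM.
- move=> i g w Gg /=; rewrite dsum_repE mulmxA -(rational_repM rhoV_rational) //.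
  by rewrite !F0E ?Ftrans ?subrr //; apply: GM.
exists (f ord0); split=> //; apply: peval_inj => w.
rewrite restrictE; have := Kf ord0 1%:M w G1 => /= /eqP.
rewrite (rational_rep1 rhoV_rational) mul1mx subr_eq0 => /eqP <-.
have := F0E 1%:M w G1; rewrite (rational_rep1 rhoV_rational) mul1mx => ->.
by rewrite /F invmx1 (rational_rep1 rhoW_rational) mul1mx.
Qed.

End DirectSum.

(** * Degrees along lines and the transfer of generating and null cone bounds *)

Section Line.
Variables (R : realType) (m k : nat) (v : 'cV[R[i]]_m) (w : 'cV[R[i]]_k).
Local Notation C := R[i].

Definition line : {mpoly C[m + k]} -> {poly C} :=
  mmap (@polyC C) (fun i => match split i with
    | inl j => (v j 0)%:P | inr j => w j 0 *: 'X end).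

Lemma lineE f c : (line f).[c] = peval f (col_mx v (c *: w)).
Proof.
rewrite /line /mmap horner_sum /peval mevalE; apply: eq_bigr => e _.
rewrite hornerM hornerC /mmap1 horner_prod; congr (_ * _).
apply: eq_bigr => i _; rewrite horner_exp mxE; congr (_ ^+ _).
by case: (split i) => j; rewrite ?hornerC // hornerZ hornerX mxE mulrC.
Qed.

Lemma lineM f h : line (f * h) = line f * line h.
Proof. exact: rmorphM. Qed.

Lemma lineX f e : line (f ^+ e) = line f ^+ e.
Proof. exact: rmorphXn. Qed.

Lemma line_sum (I : Type) (r : seq I) (f : I -> {mpoly C[m + k]}) :
  line (\sum_(i <- r) f i) = \sum_(i <- r) line (f i).
Proof. exact: raddf_sum. Qed.

Lemma lineC c : line c%:MP = c%:P.
Proof. exact: mmapC. Qed.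

End Line.

Section DegreeBound.
Variable F : idomainType.
Implicit Types p q : {poly F}.

(** Slopes are quotients of degrees, hence the rational bound. The zero polynomial counts as having
    degree 0, so sums require a nonnegative bound. *)
Definition degree_le (b : rat) p : Prop := (size p).-1%:R <= b.

Lemma degree_leD b p q : degree_le b p -> degree_le b q -> degree_le b (p + q).
Proof.
rewrite /degree_le => pb qb.
have [le|le] := leqP (size p) (size q).
  apply: le_trans qb; rewrite ler_nat -!subn1 leq_sub2r //.
  by apply: leq_trans (size_polyD _ _) _; rewrite geq_max le leqnn.
apply: le_trans pb; rewrite ler_nat -!subn1 leq_sub2r //.
by apply: leq_trans (size_polyD _ _) _; rewrite geq_max leqnn ltnW.
Qed.

Lemma degree_le_sum (I : Type) (r : seq I) b (p : I -> {poly F}) : 0 <= b ->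
  (forall i, degree_le b (p i)) -> degree_le b (\sum_(i <- r) p i).
Proof.
move=> b0 pb; apply: big_ind => //; last by move=> ? ?; apply: degree_leD.
by rewrite /degree_le size_poly0.
Qed.

Lemma degree_leM a b p q : degree_le a p -> degree_le b q -> degree_le (a + b) (p * q).
Proof.
rewrite /degree_le => pa qb; apply: le_trans (lerD pa qb).
rewrite -natrD ler_nat.
have [->|p0] := eqVneq p 0; first by rewrite mul0r size_poly0.
have [->|q0] := eqVneq q 0; first by rewrite mulr0 size_poly0.
rewrite size_mul //; move: p0 q0; rewrite -!size_poly_gt0; lia.
Qed.

End DegreeBound.

Section SigmaBound.
Variables (R : realType) (n : nat) (G : set 'M[R[i]]_n).
Variables (m k : nat).
Variables (rhoV : 'M[R[i]]_n -> 'M[R[i]]_m) (rhoW : 'M[R[i]]_n -> 'M[R[i]]_k).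
Hypothesis rhoV_rational : rational_rep G rhoV.
Hypothesis rhoW_rational : rational_rep G rhoW.
Local Notation C := R[i].
Local Notation rho := (dsum_rep rhoV rhoW).
Variable v : 'cV[C]_m.
Local Notation H := (rep_stabilizer G rhoV v).
Hypothesis G_reductive : reductive G.
Hypothesis orbit_closed : zariski_closed (rep_orbit G rhoV v).

(** The restriction of a generator need not be homogeneous, but its degree does not grow, and its
    homogeneous components are again invariant under the stabilizer. *)
Lemma generated_in_degree_restrict D :
  generated_in_degree G rho D -> generated_in_degree H rhoW D.
Proof.
move=> genG h /(restrict_surjective rhoV_rational rhoW_rational G_reductive orbit_closed).
move=> [f [/genG[l [t [p [tD ->]]]] <-]].
have -> : restrict_at v (p \mPo t) = p \mPo [tuple restrict_at v (tnth t i) | i < l].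
  apply: meval_inj => z; rewrite !comp_mpoly_meval; apply: meval_eq => i.
  by rewrite tnth_mktuple comp_mpoly_meval.
apply: in_subalgebra_comp => i; rewrite tnth_mktuple.
have [d dD [tinv td]] := tD i.
have sD : (msize (restrict_at v (tnth t i)) <= D.+1)%N.
  apply: leq_trans (msize_restrict _ _) _; rewrite msizeE.
  apply/bigmax_leqP_seq => e et _; move/dhomogP: td => /(_ e et) /= ->.
  by rewrite ltnS.
rewrite (pihomog_partitionE sD); apply: in_subalgebra_sum => j.
apply: in_subalgebra_gen; exists j; first by rewrite -ltnS.
exact/pihomog_invariant/restrict_invariant.
Qed.

(* Homogeneous invariants f of degree at most D are constant along the line
   (v, t w).  As a power of every homogeneous invariant of positive degree lies
   in the ideal generated by those, the largest slope (degree in t) / (degree)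
   among all homogeneous invariants must be zero. *)
Lemma line_invariant_const D w d f : null_cone_cut_in_degree G rho D ->
  zero_locus [set h | exists2 d, (1 <= d <= D)%N & homog_invariant H rhoW d h] w ->
  homog_invariant G rho d f -> (size (line v w f) <= 1)%N.
Proof.
move=> cutD wP fd.
have rho_rat := dsum_rep_rational rhoV_rational rhoW_rational.
have [s [e [sP gen]]] :=
  homog_invariant_generators G rho (fun d => (0 < d)%N).
have [s' [e' [sP' gen']]] :=
  homog_invariant_generators G rho (fun d => (1 <= d <= D)%N).
(* The components of the restriction of degrees 1 to D are invariants of the stabilizer and vanish
   at w; only the constant one survives on the line. *)
have line_s' (i : 'I_(size s')) : (size (line v w s'`_i) <= 1)%N.
  have [iD [iI ihom]] := sP' i; pose r := restrict_at v s'`_i.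
  have rI := restrict_invariant iI.
  have rD : (msize r <= D.+1)%N.
    apply: leq_trans (msize_restrict _ _) _; rewrite msizeE.
    apply/bigmax_leqP_seq => u us _; move/dhomogP: ihom => /(_ u us) /= ->.
    by rewrite ltnS; case/andP: iD.
  suff -> : line v w s'`_i = (peval (pihomog mdeg 0 r) w)%:P by apply: size_polyC_leq1.
  apply/eqP; rewrite -subr_eq0; apply/eqP/horner_eq0 => c.
  rewrite hornerD hornerN hornerC lineE -restrictE (peval_pihomog _ _ rD).
  rewrite big_ord_recl expr0 mul1r big1 ?addr0 ?subrr // => j _.
  rewrite wP ?mulr0 //; exists (bump 0 j); first by rewrite /bump /=; have := ltn_ord j; lia.
  exact: pihomog_invariant.
pose ratio (i : 'I_(size s)) : rat := (size (line v w s`_i)).-1%:R / (e i)%:R.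
have [mu [mu0 [mu_ge mu_at]]] : exists mu : rat, 0 <= mu /\
    (forall i, ratio i <= mu) /\ (mu != 0 -> exists i, ratio i = mu).
  have [i0|noi] := pselect (exists i : 'I_(size s), ratio i != 0); last first.
    exists 0; split=> //; split=> [i|]; last by rewrite eqxx.
    rewrite le_eqVlt; apply/orP; left; apply/negPn/negP => ri; apply: noi.
    by exists i.
  have [i _] := i0.
  have [j _ jmax] := @arg_maxP _ rat _ i xpredT ratio isT.
  exists (ratio j); split; first by rewrite divr_ge0.
  by split=> [l|_]; [exact: jmax | exists j].
(* The slope bound passes from the ideal generators to every homogeneous invariant, by induction on
   the degree with invariant coefficients. *)
have bound b x : homog_invariant G rho b x -> degree_le (mu * b%:R) (line v w x).
  have [N] := ubnP b; elim: N => // N IH in b x * => bN xb.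
  have [b0|b0] := posnP b.
    move: xb; rewrite b0 => -[_ /dhomog0_const ->]; rewrite lineC mulr0 /degree_le.
    by rewrite size_polyC; case: (_ != 0).
  have [c xE] := gen _ _ b0 xb.
  have [h [-> hP]] := homog_invariant_lift G_reductive rho_rat (fun i => (sP i).2) xb xE.
  rewrite line_sum; apply: degree_le_sum; first by rewrite mulr_ge0.
  move=> i; have [ei0 si] := sP i; rewrite lineM.
  have := hP i; case: ifP => [eib hi|_ ->]; last first.
    by rewrite -mpolyC0 lineC polyC0 mul0r /degree_le size_poly0 mulr_ge0.
  have -> : mu * b%:R = mu * (b - e i)%:R + mu * (e i)%:R.
    by rewrite -mulrDr -natrD subnK.
  apply: degree_leM; first by apply: IH hi; move: ei0 bN eib; lia.
  by have := mu_ge i; rewrite ler_pdivrMr // ltr0n.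
(* Were mu positive and attained at s_i, some power of s_i would be a combination of the s'_j, which
   are constant on the line and of degree at least 1. The coefficients have smaller degree, so the
   power would have degree on the line at most mu * (e_i * (p + 1)) - mu, but its degree is mu *
   (e_i * (p + 1)). *)
have muz : mu = 0.
  apply/eqP; apply: contrapT => /negP mun0; have [i imu] := mu_at mun0.
  have [ei0 si] := sP i.
  have [|p] := @nullstellensatz R _ (gen_ideal s') s`_i (gen_ideal_ideal s').
    move=> a aP.
    have : null_cone G rho (\col_j a j).
      rewrite cutD => x [b bD xb]; have := aP x (gen' _ _ bD xb); rewrite /peval => <-.
      by apply: meval_eq => j; rewrite mxE.
    move/(_ s`_i); rewrite /peval => zero; rewrite -zero; last by exists (e i).
    by apply: meval_eq => j; rewrite mxE.
  (* One more factor s_i guarantees a positive exponent. *)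
  move=> /(idealMl (gen_ideal_ideal s') s`_i); rewrite -exprS => -[c pE].
  have pI : homog_invariant G rho (e i * p.+1) (s`_i ^+ p.+1).
    have [iI ihom] := si; split; last exact: dhomogMn.
    by move=> g Gg z; have := iI g Gg z; rewrite /peval !rmorphXn /= => ->.
  have [h [hE hP]] := homog_invariant_lift G_reductive rho_rat (fun j => (sP' j).2) pI pE.
  have : degree_le (mu * (e i * p.+1)%:R - mu) (line v w (s`_i ^+ p.+1)).
    have pos : 0 <= mu * (e i * p.+1)%:R - mu.
      by rewrite -{2}[mu]mulr1 -mulrBr mulr_ge0 // subr_ge0 ler1n muln_gt0 ei0.
    rewrite hE line_sum; apply: degree_le_sum => // j; rewrite lineM.
    have := hP j; case: ifP => [ejp hj|_ ->]; last first.
      by rewrite -mpolyC0 lineC polyC0 mul0r /degree_le size_poly0.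
    have [/andP[ej1 _] _] := sP' j.
    have const : degree_le 0 (line v w s'`_j).
      by rewrite /degree_le; have := line_s' j; case: (size _) => [|[|]].
    have := degree_leM (bound _ _ hj) const; rewrite addr0 /degree_le => /le_trans; apply.
    rewrite -{3}[mu]mulr1 -mulrBr ler_wpM2l // natrB // lerD2l lerN2.
    by rewrite ler1n.
  rewrite /degree_le lineX size_exp natrM.
  have -> : (size (line v w s`_i)).-1%:R = mu * (e i)%:R.
    by rewrite -imu divfK // pnatr_eq0 -lt0n.
  rewrite natrM mulrA lerBrDr gerDl => mule0.
  by move: mun0; rewrite eq_le mule0 mu0.
have := bound _ _ fd; rewrite muz mul0r /degree_le.
by rewrite lern0; case: (size _) => [|[|]].
Qed.

(** Lift h to an invariant f. All components of f are constant along the line (v, t w), so h(t w)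
    does not depend on t, and h(w) = h(0) = 0 as h has positive degree. *)
Lemma null_cone_cut_restrict D :
  null_cone_cut_in_degree G rho D -> null_cone_cut_in_degree H rhoW D.
Proof.
move=> cutD; apply/seteqP; split=> w wP h.
  by move=> [d /andP[d0 _] hd]; apply: wP; exists d.
move=> [d d0 [hI hd]].
have [f [fI fh]] := restrict_surjective rhoV_rational rhoW_rational
  G_reductive orbit_closed hI.
have hE c : peval h (c *: w) = (line v w f).[c] by rewrite lineE -restrictE fh.
have [c fc] : exists c, line v w f = c%:P.
  exists (line v w f)`_0; apply: size1_polyC.
  rewrite (pihomog_partitionE (leqnn (msize f))) line_sum.
  apply: leq_trans (size_sum _ _ _) _; apply/bigmax_leqP_seq => j _ _.
  exact: line_invariant_const cutD wP (pihomog_invariant _ fI).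
have := hE 1; have := hE 0; rewrite fc !hornerC (dhomog_peval _ _ hd) expr0n scale1r.
by rewrite eqn0Ngt d0 mul0r => <-.
Qed.

End SigmaBound.

(** * Restriction as a homomorphism of invariant rings *)

Section RestrictionMorphism.
Variables (R : realType) (n : nat) (G : set 'M[R[i]]_n).
Variables (m k : nat).
Variables (rhoV : 'M[R[i]]_n -> 'M[R[i]]_m) (rhoW : 'M[R[i]]_n -> 'M[R[i]]_k).
Variable v : 'cV[R[i]]_m.
Local Notation A := (invring G (dsum_rep rhoV rhoW)).
Local Notation B := (invring (rep_stabilizer G rhoV v) rhoW).

Lemma restrict_at_invariants (f : A) :
  restrict_at v f \in invariants (rep_stabilizer G rhoV v) rhoW.
Proof. by apply/asboolP/restrict_invariant/asboolP/(valP f). Qed.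

Definition restrict_invring (f : A) : B := Invring (restrict_at_invariants f).

Lemma restrict_invring_is_linear : linear restrict_invring.
Proof. by move=> a f h; apply: val_inj; rewrite /= /restrict_at linearP. Qed.

Lemma restrict_invring_is_monoid_morphism : monoid_morphism restrict_invring.
Proof.
split=> [|f h]; apply: val_inj; rewrite /= /restrict_at; first exact: rmorph1.
exact: rmorphM.
Qed.

HB.instance Definition _ := GRing.isLinear.Build R[i] A B *:%R restrict_invring
  restrict_invring_is_linear.
HB.instance Definition _ := GRing.isMonoidMorphism.Build A B restrict_invring
  restrict_invring_is_monoid_morphism.

End RestrictionMorphism.

Theorem theorem1p5 (R : realType) (n : nat) (G : set 'M[R[i]]_n)
  (m k : nat)
  (rhoV : 'M[R[i]]_n -> 'M[R[i]]_m) (rhoW : 'M[R[i]]_n -> 'M[R[i]]_k)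
  (v : 'cV[R[i]]_m)
  (G_reductive : reductive G)
  (rhoV_rational : rational_rep G rhoV)
  (rhoW_rational : rational_rep G rhoW)
  (orbit_closed : zariski_closed (rep_orbit G rhoV v))
  (H_reductive : reductive (rep_stabilizer G rhoV v)) :
  (exists phi : {lrmorphism invring G (dsum_rep rhoV rhoW) ->
                            invring (rep_stabilizer G rhoV v) rhoW},
      degree_nonincreasing phi /\ (forall h, exists f, phi f = h)) /\
  (beta (rep_stabilizer G rhoV v) rhoW <= beta G (dsum_rep rhoV rhoW))%N /\
  (sigma (rep_stabilizer G rhoV v) rhoW <= sigma G (dsum_rep rhoV rhoW))%N.
Proof.
have rho_rational := dsum_rep_rational rhoV_rational rhoW_rational.
split; last split.
- exists (@restrict_invring _ _ G _ _ rhoV rhoW v).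
  split=> [f|h]; first exact: msize_restrict.
  have /asboolP := valP h.
  move=> /(restrict_surjective rhoV_rational rhoW_rational G_reductive orbit_closed).
  move=> [f [fI fh]]; have fA : f \in invariants G (dsum_rep rhoV rhoW) by apply/asboolP.
  by exists (Invring fA); apply: val_inj.
(* Hilbert finiteness ensures that [beta] for [G] is a true generating degree and not the default
   value 0 of [least]. *)
- have [D /least_le[gen _]] := hilbert_finiteness G_reductive rho_rational.
  have genH := generated_in_degree_restrict rhoV_rational rhoW_rational
    G_reductive orbit_closed gen.
  by have [] := least_le genH.
- have [D /least_le[cut _]] := null_cone_finiteness G (dsum_rep rhoV rhoW).
  have cutH := null_cone_cut_restrict rhoV_rational rhoW_rational
    G_reductive orbit_closed cut.
  by have [] := least_le cutH.
Qed.
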